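(* Let $\varphi\colon\mathcal{X}\to\,]-\infty,+\infty]$ be proper, let $\varnothing\neq\mathcal{D}\subset\mathcal{X}$, let $W\colon\mathcal{D}\to\mathcal{X}^*$, let $x\in\mathcal{D}$, let $u^*\in\mathcal{X}^*$, and let $\gamma\in\,]0,+\infty[$. Suppose that $\mathcal{D}\cap\operatorname{dom}\partial\varphi\neq\varnothing$ and that one of properties (i)--(iii) below is satisfied, together with one of properties (iv)--(vii): (i) $W+\gamma\partial\varphi$ is injective. (ii) $W+\gamma\partial\varphi$ is strictly monotone. (iii) $W$ is uniformly monotone. (iv) $Wx+\gamma u^*\in\operatorname{ran}(W+\gamma\partial\varphi)$. (v) $W$ is monotone, $W+\gamma\partial\varphi$ is maximally monotone, $\operatorname{ran}W+\gamma\operatorname{ran}\partial\varphi=\mathcal{X}^*$, and one of the following is satisfied: (a) $W$ is $3^*$ monotone; (b) $\operatorname{dom}W\subset\operatorname{dom}\partial\varphi$. (vi) $W=\partial f$ with $f\in\Gamma_0(\mathcal{X})$, $\varphi\in\Gamma_0(\mathcal{X})$, the cone generated by $\operatorname{dom}f-\operatorname{dom}\varphi$ is a closed vector subspace of $\mathcal{X}$, and $\operatorname{dom}\partial f^*+\gamma\operatorname{dom}\partial\varphi^*=\mathcal{X}^*$. (vii) $W$ is monotone, $W+\gamma\partial\varphi$ is maximally monotone, and one of the following is satisfied: (a) $W$ is $3^*$ monotone and surjective; (b) $\partial\varphi$ is surjective. Then $\operatorname{prox}^W_{\gamma(\varphi-u^* )}x$ is a singleton and, setting $z=\operatorname{prox}^W_{\gamma(\varphi-u^*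 )}x$, $$L_\varphi(x,u^* )\geq\frac{\langle x-z,Wx-Wz\rangle}{\gamma}.$$
   Context: $\mathcal{X}\neq\{0\}$ is a reflexive real Banach space with topological dual $\mathcal{X}^*$, and $\langle\cdot,\cdot\rangle$ is the canonical duality pairing. A function $\varphi\colon\mathcal{X}\to\,]-\infty,+\infty]$ is proper if $\operatorname{dom}\varphi=\{\varphi<+\infty\}\neq\varnothing$; its conjugate is $\varphi^*\colon x^*\mapsto\sup_{x}(\langle x,x^*\rangle-\varphi(x))$; its Fenchel--Young function is $L_\varphi\colon(x,u^* )\mapsto\varphi(x)+\varphi^*(u^* )-\langle x,u^*\rangle$; its subdifferential (no convexity required) is $\partial\varphi\colon x\mapsto\{x^*\in\mathcal{X}^*\mid(\forall y\in\mathcal{X})\ \langle y-x,x^*\rangle+\varphi(x)\leq\varphi(y)\}$. $\varphi-u^*$ denotes the function $y\mapsto\varphi(y)-\langle y,u^*\rangle$. $\Gamma_0(\mathcal{X})$ is the class of proper lower semicontinuous convex functions from $\mathcal{X}$ to $]-\infty,+\infty]$. For $A\colon\mathcal{X}\to 2^{\mathcal{X}^*}$: $\operatorname{gra}A=\{(x,x^* )\mid x^*\in Ax\}$, $\operatorname{dom}A=\{x\mid Ax\neq\varnothing\}$, $\operatorname{ran}A=\bigcup_xAx$, $A^{-1}x^*=\{x\mid x^*\in Ax\}$; images of sets and compositions are unions of images; $A$ is surjective if $\operatorname{ran}A=\mathcal{X}^*$. A map $W\colon\mathcal{D}\to\mathcal{X}^*$ is identified with the set-valued operator equal to $\{Wx\}$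 for $x\in\mathcal{D}$ and $\varnothing$ otherwise, so $\operatorname{dom}W=\mathcal{D}$. The warped proximity operator of $\varphi$ with kernel $K\colon\mathcal{X}\to2^{\mathcal{X}^*}$ is $\operatorname{prox}_\varphi^K=(K+\partial\varphi)^{-1}\circ K$; a singleton value is identified with its element. $A$ is monotone if $\langle x-y,x^*-y^*\rangle\geq0$ for all $(x,x^* ),(y,y^* )\in\operatorname{gra}A$, strictly monotone if moreover the inequality is strict whenever $x\neq y$, and maximally monotone if, for every $(x,x^* )$, $(x,x^* )\in\operatorname{gra}A$ iff $\langle x-y,x^*-y^*\rangle\geq0$ for every $(y,y^* )\in\operatorname{gra}A$. $A$ is uniformly monotone if there is an increasing $\phi\colon[0,+\infty[\,\to[0,+\infty]$ vanishing only at $0$ such that $\langle x-y,x^*-y^*\rangle\geq\phi(\|x-y\|)$ for all $(x,x^* ),(y,y^* )\in\operatorname{gra}A$. $A$ is $3^*$ monotone if it is monotone and, for every $(x,u^* )\in\operatorname{dom}A\times\operatorname{ran}A$, $\sup_{(y,y^* )\in\operatorname{gra}A}\langle x-y,y^*-u^*\rangle<+\infty$. $A$ is injective if $Ax\cap Ay\neq\varnothing$ implies $x=y$. *)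

(* Defs.v *)
From HB Require Import structures.
From mathcomp Require Import all_boot all_order all_algebra.
From mathcomp Require Import interval_inference.
From mathcomp Require Import boolp classical_sets functions.
From mathcomp Require Import reals ereal topology tvs normedtype.

Set Implicit Arguments.
Unset Strict Implicit.
Unset Printing Implicit Defensive.

Import Order.TTheory GRing.Theory Num.Theory.
Import numFieldNormedType.Exports.

Local Open Scope classical_set_scope.
Local Open Scope ring_scope.

Definition continuous_linear (R : realType) (X : normedModType R)
    : {pred X -> R^o} :=
  mem [set f : X -> R^o | linear f /\ continuous f].

Record dual_space (R : realType) (X : normedModType R) := Dual {
  dual_fun :> X -> R^o;
  dual_funP : dual_fun \in @continuous_linear R X }.

Section dual_lmodule.
Context {R : realType} {X : normedModType R}.
Local Notation X' := (dual_space X).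
Implicit Types f g : X'.

HB.instance Definition _ := [isSub for @dual_fun R X].
HB.instance Definition _ := [Choice of X' by <:].

Lemma dual_linear f : linear f.
Proof. by have /set_mem[] := dual_funP f. Qed.

Lemma dual_continuous f : continuous f.
Proof. by have /set_mem[] := dual_funP f. Qed.

HB.instance Definition _ f :=
  GRing.isLinear.Build R X R^o _ f (dual_linear f).

Lemma continuous_linear_submod_closed : submod_closed (@continuous_linear R X).
Proof.
split; first apply: mem_set; first split.
- by move=> a x y; change (0 = a *: 0 + 0 :> R^o); rewrite scaler0 addr0.
- exact: cst_continuous.
move=> a f g /set_mem[lf cf] /set_mem[lg cg]; apply: mem_set; split.
- move=> b x y; change (a *: f (b *: x + y) + g (b *: x + y) =
    b *: (a *: f x + g x) + (a *: f y + g y)).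
  rewrite lf lg !scalerDr !scalerA (mulrC a b).
  by rewrite -!addrA; congr (_ + _); rewrite addrCA.
- move=> x; have afx := @cvgZl_tmp _ _ _ _ (nbhs_filter x) a _ _ (cf x).
  have := @cvgD _ _ _ _ _ (a \*: f) g _ _ afx (cg x); exact.
Qed.

HB.instance Definition _ := GRing.isSubmodClosed.Build R (X -> R^o)
  (@continuous_linear R X) continuous_linear_submod_closed.
HB.instance Definition _ := [SubChoice_isSubLmodule of X' by <:].

Lemma dualP f g : f =1 g -> f = g.
Proof. by move=> fg; apply: val_inj; exact/funext. Qed.

Lemma dual_addE f g x : (f + g) x = f x + g x.
Proof. by []. Qed.

Lemma dual_scaleE a f x : (a *: f) x = a * f x.
Proof. by []. Qed.

Definition dual_norm f : R := sup [set `|f x| | x in [set x | `|x| <= 1]].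

Lemma dual_norm_has_sup f : has_sup [set `|f x| | x in [set x | `|x| <= 1]].
Proof.
split; first by exists `|f 0|, 0 => //=; rewrite normr0.
have /linear_bounded_continuous/linear_boundedP := @dual_continuous f.
move=> /pinfty_ex_gt0[M M0 fM]; exists M => _ [x /= x1 <-].
by rewrite (le_trans (fM x))// ler_piMr// ltW.
Qed.

Lemma dual_norm_ge f x : `|x| <= 1 -> `|f x| <= dual_norm f.
Proof.
by move=> x1; apply: sup_upper_bound; [exact: dual_norm_has_sup|exists x].
Qed.

Lemma dual_norm_le f M :
  (forall x, `|x| <= 1 -> `|f x| <= M) -> dual_norm f <= M.
Proof.
move=> fM; apply: ge_sup; last by move=> _ [x /= x1 <-]; exact: fM.
by have [] := dual_norm_has_sup f.
Qed.

Lemma ler_dual_normD f g : dual_norm (f + g) <= dual_norm f + dual_norm g.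
Proof.
apply: dual_norm_le => x x1; rewrite dual_addE.
by rewrite (le_trans (ler_normD _ _))// lerD// dual_norm_ge.
Qed.

Lemma dual_normZ_le a f : dual_norm (a *: f) <= `|a| * dual_norm f.
Proof.
apply: dual_norm_le => x x1; rewrite dual_scaleE normrM.
by rewrite ler_wpM2l// dual_norm_ge.
Qed.

Lemma dual_normZ a f : dual_norm (a *: f) = `|a| * dual_norm f.
Proof.
apply/eqP; rewrite eq_le dual_normZ_le/=.
have [->|a0] := eqVneq a 0.
  rewrite normr0 mul0r (le_trans (normr_ge0 ((0 *: f) 0)))//.
  by rewrite dual_norm_ge// normr0.
rewrite -ler_pdivlMl ?normr_gt0// -normfV.
by rewrite (le_trans _ (dual_normZ_le _ _))// scalerA mulVf// scale1r.
Qed.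

Lemma dual_norm0_eq0 f : dual_norm f = 0 -> f = 0.
Proof.
move=> f0; apply: dualP => x.
have [->|x0] := eqVneq x 0; first by rewrite !linear0.
have : `|f (`|x|^-1 *: x)| <= 0 by rewrite -f0 dual_norm_ge// normfZV.
rewrite linearZ/= normr_le0 scaler_eq0 invr_eq0 normr_eq0 (negbTE x0)/=.
by move=> /eqP.
Qed.

HB.instance Definition _ := Lmodule_isNormed.Build R X'
  ler_dual_normD dual_normZ dual_norm0_eq0.

Lemma dual_normE f : `|f| = sup [set `|f x| | x in [set x | `|x| <= 1]].
Proof. by []. Qed.

End dual_lmodule.

Definition pairing (R : realType) (X : normedModType R) (x : X)
  (f : dual_space X) : R := f x.

Notation "⟨ x , f ⟩" := (pairing x f)
  (at level 0, x at level 99, f at level 99, format "⟨ x ,  f ⟩")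
  : ring_scope.

(** The canonical isometry of [X] into its bidual is onto. *)
Definition reflexive_space (R : realType) (X : normedModType R) :=
  forall F : dual_space (dual_space X), exists x : X,
    forall f : dual_space X, ⟨f, F⟩ = ⟨x, f⟩.

Section setops.
Context {R : realType} {U V : lmodType R}.

Definition msum (A B : set V) : set V := [set a + b | a in A & b in B].
Definition mscale (c : R) (A : set V) : set V := [set c *: a | a in A].

Definition op_add (A B : U -> set V) : U -> set V :=
  fun x => msum (A x) (B x).
Definition op_scale (c : R) (A : U -> set V) : U -> set V :=
  fun x => mscale c (A x).

End setops.

Section operators.
Context {U V : Type}.
Implicit Types A : U -> set V.

Definition op_gra A : set (U * V) := [set p | A p.1 p.2].
Definition op_dom A : set U := [set x | A x !=set0].
Definition op_ran A : set V := \bigcup_x A x.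
Definition op_inv A : V -> set U := fun v => [set x | A x v].
Definition op_injective A := forall x y, A x `&` A y !=set0 -> x = y.
Definition op_surjective A := op_ran A = setT.

Definition op_comp (W : Type) (B : V -> set W) A : U -> set W :=
  fun x => \bigcup_(y in A x) B y.

(** The set-valued operator identified with a map defined on [D] only: it is
    empty outside [D]. *)
Definition op_of (D : set U) (W : D -> V) : U -> set V :=
  fun x => [set W d | d in [set d : D | val d = x]].

End operators.

Section monotonicity.
Context {R : realType} {X : normedModType R}.
Implicit Types A : X -> set (dual_space X).

Definition monotone A := forall p q, op_gra A p -> op_gra A q ->
  0 <= ⟨p.1 - q.1, p.2 - q.2⟩.

Definition strictly_monotone A := monotone A /\
  forall p q, op_gra A p -> op_gra A q -> p.1 != q.1 ->
    0 < ⟨p.1 - q.1, p.2 - q.2⟩.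

Definition maximally_monotone A := forall p,
  op_gra A p <-> (forall q, op_gra A q -> 0 <= ⟨p.1 - q.1, p.2 - q.2⟩).

(** "Increasing" is meant in the wide sense; only the values of [phi] on the
    nonnegative half-line matter. *)
Definition uniformly_monotone A := exists phi : R -> \bar R,
  [/\ forall t, 0 <= t -> (0 <= phi t)%E,
      forall s t, 0 <= s -> s <= t -> (phi s <= phi t)%E,
      forall t, 0 <= t -> (phi t = 0%E <-> t = 0) &
      forall p q, op_gra A p -> op_gra A q ->
        (phi `|p.1 - q.1|%R <= (⟨p.1 - q.1, p.2 - q.2⟩)%:E)%E].

(** 3*-monotonicity, also known as the Brezis-Haraux property. *)
Definition star_monotone A := monotone A /\
  forall x u, op_dom A x -> op_ran A u ->
    (ereal_sup [set (⟨x - p.1, p.2 - u⟩)%:E | p in op_gra A] < +oo)%E.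

End monotonicity.

Section convex_analysis.
Context {R : realType} {X : normedModType R}.
Implicit Types phi : X -> \bar R.
Local Open Scope ereal_scope.

Definition fdom phi : set X := [set x | phi x < +oo].

Definition proper_fun phi := (forall x, -oo < phi x) /\ fdom phi !=set0.

Definition fconjugate phi : dual_space X -> \bar R :=
  fun f => ereal_sup [set (⟨x, f⟩)%:E - phi x | x in setT].

Definition fenchel_young phi (x : X) (f : dual_space X) : \bar R :=
  phi x + fconjugate phi f - (⟨x, f⟩)%:E.

Definition subdiff phi : X -> set (dual_space X) :=
  fun x => [set f | forall y, (⟨(y - x)%R, f⟩)%:E + phi x <= phi y].

(** The function written [phi - u] for [u] in the dual. *)
Definition tilt phi (u : dual_space X) : X -> \bar R :=
  fun y => phi y - (⟨y, u⟩)%:E.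

(** Restricting to [0 < t < 1] avoids the products [0 * +oo]. *)
Definition econvex phi := forall x y (t : R), (0 < t < 1)%R ->
  phi (t *: x + (1 - t) *: y)%R <= t%:E * phi x + (1 - t)%:E * phi y.

Definition Gamma0 phi :=
  [/\ proper_fun phi, lower_semicontinuous phi & econvex phi].

Definition warped_prox (K : X -> set (dual_space X)) phi : X -> set X :=
  op_comp (op_inv (op_add K (subdiff phi))) K.

End convex_analysis.

Section cones.
Context {R : realType} {X : normedModType R}.
Implicit Types C D : set X.

Definition mdiff C D : set X := [set c - d | c in C & d in D].

Definition cone_gen C : set X := \bigcup_(t in [set t : R | 0 < t]) mscale t C.

Definition closed_subspace C := closed C /\ submod_closed (mem C).

End cones.

(* Main.v *)
Require Import Defs.
From HB Require Import structures.
From mathcomp Require Import all_boot all_order all_algebra.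
From mathcomp Require Import interval_inference.
From mathcomp Require Import boolp classical_sets functions.
From mathcomp Require Import prodnormedzmodule reals ereal topology tvs.
From mathcomp Require Import normedtype sequences.
From mathcomp Require Import ring lra.

(** Put [A = W + gamma * subdiff phi]. A point [z] belongs to the proximal set of
    [x] exactly when [W x + gamma * u] belongs to [A z], because the
    subdifferential of [gamma * (phi - u)] is [gamma * (subdiff phi - u)]. The
    injectivity or monotonicity hypothesis makes [A] injective, so there is at
    most one such [z]. If there is one, then [u + (W x - W z) / gamma] is a
    subgradient of [phi] at [z], and adding the subgradient inequality between [z]
    and [x] to the Fenchel-Young bound [<z, u> - phi z <= phi^* u] gives the
    estimate. What is left is that [A] is surjective, unless [W x + gamma * u] is
    assumed to be in its range.

    The two surjectivity theorems follow one scheme. A convex function [h] on a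
    normed space satisfies [0 <= h 0], and any continuous linear minorant of [h]
    yields a solution. By the Hahn-Banach theorem ([hahn_banach_convex]) there is
    one as soon as [- M |e| <= h e] for some [M]. The problems are self-dual,
    hence [h e] is bounded below by a duality product of [e] with the very
    variables over which [h] is an infimum. These variables are pointwise bounded
    where [h <= 0], thus bounded by [uniform_boundedness], up to a weight
    [1 + |e|], and the bound on [h] follows. The hypotheses on sums of ranges or
    of domains are what provides the pointwise bounds. Reflexivity turns the
    functional on the dual space into a point.

    - When [A] is maximally monotone, [h] is the partial infimum over the space of
      the conjugate of the Fitzpatrick function of [A]. This gives a
      Brezis-Haraux theorem ([surjective_of_bounded_above]): a maximally monotone
      [T] is surjective if for every [u] some [x] makes [<x - y, v - u>] bounded
      above on the graph of [T]. Subdifferentials have this property at each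
      point of their domain ([subdiff_bounded_above]), and the assumptions on [W]
      give it for [W].
    - When [W] is the subdifferential of [f], [h] is the value function of the
      primal-dual problem of minimizing [f + gamma * phi - p], and its minorant is
      a pair formed by a minimizer and a subgradient of [f] there whose
      difference with [p] is a subgradient of [gamma * phi]
      ([subdiff_sum_surjective]). Semicontinuity and convexity of the two
      functions enter through the Fenchel-Moreau theorem
      ([Gamma0_affine_supported]), another consequence of the Hahn-Banach
      theorem. *)

Set Implicit Arguments.
Unset Strict Implicit.
Unset Printing Implicit Defensive.

Import Order.TTheory GRing.Theory Num.Theory.
Import numFieldNormedType.Exports.
Import ProdNormedZmodule.Exports.
Local Open Scope classical_set_scope.
Local Open Scope ring_scope.

(** * Duality pairing *)

(* Pairings stay folded so that the bilinearity rules below apply to them. *)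
Arguments pairing : simpl never.

Lemma bounded_linear_dual (R : realType) (E : normedModType R) (l : E -> R)
    (M : R) :
  (forall a x y, l (a *: x + y) = a * l x + l y) ->
  (forall x, `|l x| <= M * `|x|) ->
  exists f : dual_space E, forall x, f x = l x.
Proof.
move=> ll lM.
have ll' : linear (l : E -> R^o) by [].
pose l' : {linear E -> R^o} := HB.pack (l : E -> R^o)
  (GRing.isLinear.Build _ _ _ _ (l : E -> R^o) ll').
have cl : continuous (l : E -> R^o).
  apply: (@bounded_linear_continuous R E R^o l').
  apply/linear_boundedP.
  apply: filterS (nbhs_pinfty_ge (num_real M)) => r Mr x.
  by rewrite (le_trans (lM x))// ler_wpM2r.
have lP : (l : E -> R^o) \in @continuous_linear R E by apply: mem_set.
by exists (Dual lP).
Qed.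

Lemma dual_norm_bound (R : realType) (E : normedModType R) (f : dual_space E)
    (x : E) : `|f x| <= `|f| * `|x|.
Proof.
have [->|x0] := eqVneq x 0; first by rewrite linear0 !normr0 mulr0.
have xp : 0 < `|x| by rewrite normr_gt0.
have := @dual_norm_ge R E f (`|x|^-1 *: x).
rewrite normfZV// lexx => /(_ isT).
by rewrite linearZ/= normrM normfV normr_id mulrC ler_pdivrMr.
Qed.

Lemma dual_bound_norm (R : realType) (E : normedModType R) (f : dual_space E)
    (M : R) : 0 <= M -> (forall x, `|f x| <= M * `|x|) -> `|f| <= M.
Proof.
move=> M0 fM; apply: dual_norm_le => x x1.
by rewrite (le_trans (fM x))// ler_piMr.
Qed.

Lemma pairingDl (R : realType) (X : normedModType R) (x y : X)
  (f : dual_space X) : ⟨x + y, f⟩ = ⟨x, f⟩ + ⟨y, f⟩.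
Proof. exact: linearD. Qed.
Lemma pairingBl (R : realType) (X : normedModType R) (x y : X)
  (f : dual_space X) : ⟨x - y, f⟩ = ⟨x, f⟩ - ⟨y, f⟩.
Proof. exact: linearB. Qed.
Lemma pairingNl (R : realType) (X : normedModType R) (x : X)
  (f : dual_space X) : ⟨- x, f⟩ = - ⟨x, f⟩.
Proof. exact: linearN. Qed.
Lemma pairing0l (R : realType) (X : normedModType R)
  (f : dual_space X) : ⟨0, f⟩ = 0.
Proof. exact: linear0. Qed.
Lemma pairingZl (R : realType) (X : normedModType R) a (x : X)
  (f : dual_space X) : ⟨a *: x, f⟩ = a * ⟨x, f⟩.
Proof. by rewrite /pairing linearZ. Qed.
Lemma pairingDr (R : realType) (X : normedModType R) (x : X)
  (f g : dual_space X) : ⟨x, f + g⟩ = ⟨x, f⟩ + ⟨x, g⟩.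
Proof. by []. Qed.
Lemma pairingZr (R : realType) (X : normedModType R) a (x : X)
  (f : dual_space X) : ⟨x, a *: f⟩ = a * ⟨x, f⟩.
Proof. by []. Qed.
Lemma pairingNr (R : realType) (X : normedModType R) (x : X)
  (f : dual_space X) : ⟨x, - f⟩ = - ⟨x, f⟩.
Proof. by rewrite -scaleN1r pairingZr mulN1r. Qed.
Lemma pairingBr (R : realType) (X : normedModType R) (x : X)
  (f g : dual_space X) : ⟨x, f - g⟩ = ⟨x, f⟩ - ⟨x, g⟩.
Proof. by rewrite pairingDr pairingNr. Qed.
Lemma pairing0r (R : realType) (X : normedModType R) (x : X)
   : ⟨x, 0 : dual_space X⟩ = 0.
Proof. by []. Qed.
Lemma pairing_le (R : realType) (X : normedModType R) (x : X)
  (f : dual_space X) : ⟨x, f⟩ <= `|f| * `|x|.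
Proof. exact: le_trans (ler_norm _) (dual_norm_bound _ _). Qed.

Lemma eval_dual (R : realType) (X : normedModType R) (x : X) :
  exists F : dual_space (dual_space X), forall f, ⟨f, F⟩ = ⟨x, f⟩.
Proof.
have [] := @bounded_linear_dual R (dual_space X) (fun f => ⟨x, f⟩) `|x| => //.
  by move=> f; rewrite mulrC; exact: dual_norm_bound.
by move=> F FE; exists F.
Qed.

(** * Hahn-Banach theorem *)

Section hahn_banach.
Context {R : realType} {E : normedModType R}.

Definition convex_cone (S : set (E * R^o)) := [/\ S 0,
  forall p q, S p -> S q -> S (p + q) &
  forall t p, 0 <= t -> S p -> S (t *: p)].

(** The set stays above the open cone [c < - M |e|]; separating it from that cone
    yields a functional of norm at most [M]. *)
Definition above_norm (M : R) (S : set (E * R^o)) :=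
  forall p, S p -> 0 <= p.2 + M * `|p.1|.

(** Zorn's lemma, as cones above the bound are stable under unions of chains. *)
Lemma maximal_cone (S : set (E * R^o)) M : convex_cone S -> above_norm M S ->
  exists A, [/\ S `<=` A, convex_cone A, above_norm M A &
    forall B, A `<=` B -> convex_cone B -> above_norm M B -> B `<=` A].
Proof.
move=> cS nS.
(* The union of the empty chain is empty, hence the guard. *)
pose P (A : set (E * R^o)) := A !=set0 ->
  [/\ S `<=` A, convex_cone A & above_norm M A].
have [|A [PA Amax]] := @Zorn_bigcup _ P.
  move=> F FP tF [p [A0 FA0 A0p]].
  have FP' A : F A -> forall p, A p ->
    [/\ S `<=` A, convex_cone A & above_norm M A].
    by move=> FA q Aq; apply: (FP A FA); exists q.
  have [SA0 cA0 nA0] := FP' _ FA0 _ A0p.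
  split.
  - by move=> q /SA0 Aq; exists A0.
  - split; first by exists A0 => //; have [] := cA0.
      move=> q r [A1 FA1 A1q] [A2 FA2 A2r].
      have [A12|A21] := tF _ _ FA1 FA2.
        exists A2 => //; have [_ [_ + _] _] := FP' _ FA2 _ A2r.
        by apply => //; exact: A12.
      exists A1 => //; have [_ [_ + _] _] := FP' _ FA1 _ A1q.
      by apply => //; exact: A21.
    move=> t q t0 [A1 FA1 A1q]; exists A1 => //.
    by have [_ [_ _ +] _] := FP' _ FA1 _ A1q; apply.
  - move=> q [A1 FA1 A1q]; have [_ _ +] := FP' _ FA1 _ A1q; exact.
have A0 : A !=set0.
  apply: contrapT => nA.
  have /Amax : A `<` S.
    split; first by move=> p Ap; case: nA; exists p.
    by move=> SA; apply: nA; exists 0; apply: SA; have [] := cS.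
  by apply => _; split.
have [SA cA nA] := PA A0; exists A; split=> // B AB cB nB.
apply: contrapT => nBA; apply: (Amax B); first by split.
by move=> _; split => //; exact: subset_trans SA AB.
Qed.

(** If neither [p] nor [- p] could be added, the two violations of the bound
    would add up to a violation inside [A]. *)
Lemma maximal_cone_total (A : set (E * R^o)) M : 0 <= M -> convex_cone A ->
  above_norm M A ->
  (forall B, A `<=` B -> convex_cone B -> above_norm M B -> B `<=` A) ->
  forall p, A p \/ A (- p).
Proof.
move=> M0 cA nA Amax.
have [A0 AD AZ] := cA.
have viol p : ~ A p -> exists a t, [/\ A a, 0 < t &
    (a + t *: p).2 + M * `|(a + t *: p).1| < 0].
  move=> nAp; apply: contrapT => nv.
  pose B := [set q | exists a t, [/\ A a, 0 <= t & q = a + t *: p]].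
  apply: nAp; apply: (Amax B).
  - by move=> a Aa; exists a, 0; rewrite scale0r addr0.
  - split; first by exists 0, 0; rewrite scale0r addr0.
      move=> _ _ [a [t [Aa t0 ->]]] [b [s [Ab s0 ->]]].
      exists (a + b), (t + s); split; [exact: AD|exact: addr_ge0|].
      by rewrite scalerDl addrACA.
    move=> t _ t0 [a [s [Aa s0 ->]]]; exists (t *: a), (t * s).
    by split; [exact: AZ|exact: mulr_ge0|rewrite scalerDr scalerA].
  - move=> _ [a [t [Aa t0 ->]]]; rewrite leNgt; apply/negP => v.
    move: t0; rewrite le_eqVlt => /predU1P[t0|t0].
      by move: v; rewrite -t0 scale0r addr0 ltNge nA.
    by apply: nv; exists a, t.
  - by exists 0, 1; rewrite scale1r add0r.
move=> p; apply: contrapT => /not_orP[/viol[a [t [Aa t0 v]]]].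
move=> /viol[b [s [Ab s0 w]]].
have := nA _ (AD _ _ (AZ _ _ (ltW s0) Aa) (AZ _ _ (ltW t0) Ab)).
apply/negP; rewrite -ltNge.
have -> : s *: a + t *: b = s *: (a + t *: p) + t *: (b + s *: (- p)).
  rewrite !scalerDr !scalerA scalerN (mulrC t s) addrACA subrr addr0//.
move: v w; set q := a + _; set r := b + _ => v w /=.
have h : M * `|s *: q.1 + t *: r.1| <= s * (M * `|q.1|) + t * (M * `|r.1|).
  rewrite [s * _]mulrCA [t * _]mulrCA -mulrDr ler_wpM2l//.
  by rewrite (le_trans (ler_normD _ _))// !normrZ (gtr0_norm s0) (gtr0_norm t0).
apply: (@le_lt_trans _ _ (s * (q.2 + M * `|q.1|) + t * (r.2 + M * `|r.1|))).
  change (s * q.2 + t * r.2 + M * `|s *: q.1 + t *: r.1| <=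
    s * (q.2 + M * `|q.1|) + t * (r.2 + M * `|r.1|)).
  rewrite !mulrDr [leRHS]addrACA lerD2l; exact: h.
by rewrite -[ltRHS]addr0 ltrD// pmulr_rlt0.
Qed.

(** A maximal cone [A] is a half-space by [maximal_cone_total]: its lower boundary
    [l] is subadditive since [A] is a cone, and odd since [A] contains [p] or
    [- p] for each [p]. *)
Theorem hahn_banach_cone (S : set (E * R^o)) M : 0 <= M -> convex_cone S ->
  above_norm M S -> exists l : dual_space E, forall p, S p -> ⟨p.1, l⟩ <= p.2.
Proof.
move=> M0 cS nS.
have [A [SA cA nA Amax]] := maximal_cone cS nS.
have Atot e (c : R) : A (e, c) \/ A (- e, - c).
  exact: (maximal_cone_total M0 cA nA Amax (e, c)).
have [A0 AD AZ] := cA.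
have Alb e c : A (e, c) -> - (M * `|e|) <= c.
  by move=> /nA/=; rewrite -lerBlDr sub0r.
have A1 c : 0 <= c -> A (0, c).
  move=> c0; have [//|/Alb] := Atot 0 c.
  rewrite oppr0 normr0 mulr0 oppr0 => Nc0.
  have -> : c = 0 by apply/eqP; rewrite eq_le c0 andbT -oppr_ge0.
  exact: A0.
have Aup e c d : c <= d -> A (e, c) -> A (e, d).
  move=> cd Ac; have := AD _ _ Ac (A1 (d - c) _); rewrite subr_ge0.
  move=> /(_ cd); congr (A _).
  by rewrite /GRing.add/= /add_pair/= addr0 addrC subrK.
pose I e := [set c : R | A (e, c)].
pose l e := inf (I e).
have IM e c : M * `|e| < c -> I e c.
  move=> Mc; have [//|/Alb] := Atot e c.
  by rewrite /= normrN lerN2 leNgt Mc.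
have I0 e : has_inf (I e).
  split; first by exists (M * `|e| + 1); apply: IM; rewrite ltrDl.
  by exists (- (M * `|e|)) => c; exact: Alb.
have lle e c : A (e, c) -> l e <= c.
  by move=> Ac; apply: ge_inf => //; have [] := I0 e.
have lI e c : l e < c -> A (e, c).
  move=> lc; have [d Ad dc] := inf_lt (I0 e).1 lc.
  exact: Aup (ltW dc) Ad.
have lb e m : (forall c, A (e, c) -> m <= c) -> m <= l e.
  by move=> h; apply: lb_le_inf => //; have [] := I0 e.
have lD e e' : l (e + e') <= l e + l e'.
  apply/ler_addgt0Pr => r r0.
  have -> : l e + l e' + r = (l e + r / 2) + (l e' + r / 2) by lra.
  apply: lle; apply: (AD (_, _) (_, _)); apply: lI; rewrite ltrDl divr_gt0//.
have lZ t e : 0 < t -> l (t *: e) <= t * l e.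
  move=> t0; rewrite -ler_pdivrMl//; apply: lb => c Ac.
  rewrite ler_pdivrMl//; apply: lle; exact: (AZ t (_, _) (ltW t0) Ac).
have lN e : l (- e) <= - l e.
  rewrite leNgt; apply/negP => ne.
  have : ~ A (e, - l (- e) + (l (- e) + l e) / 2).
    by move=> /lle; lra.
  have [//|/= Ae _] := Atot e (- l (- e) + (l (- e) + l e) / 2).
  have : l (- e) <= - (- l (- e) + (l (- e) + l e) / 2) by exact: lle.
  lra.
have l0 : l 0 = 0.
  apply/eqP; rewrite eq_le; apply/andP; split; first by apply: lle; exact: A0.
  by apply: lb => c /Alb; rewrite normr0 mulr0 oppr0.
have lN' e : l (- e) = - l e.
  apply/eqP; rewrite eq_le lN/=.
  by have := lD e (- e); rewrite subrr l0 => ?; lra.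
have lD' e e' : l (e + e') = l e + l e'.
  apply/eqP; rewrite eq_le lD/=.
  have := lD (e + e') (- e'); rewrite addrK lN' => ?; lra.
have lZp t e : 0 < t -> l (t *: e) = t * l e.
  move=> t0; apply/eqP; rewrite eq_le lZ//=.
  have := lZ t (- e) t0; rewrite scalerN !lN' => ?; lra.
have lZ' t e : l (t *: e) = t * l e.
  have [t0|t0|<-] := ltgtP 0 t.
  - exact: lZp.
  - rewrite -(opprK t) scaleNr lN' lZp ?oppr_gt0//; lra.
  - by rewrite scale0r l0 mul0r.
have lM e : l e <= M * `|e|.
  by apply/ler_addgt0Pr => r r0; apply: lle; apply: IM; rewrite ltrDl.
have [||f fl] := @bounded_linear_dual _ _ l M.
- by move=> a x y; rewrite lD' lZ'.
- move=> x; rewrite ler_norml lM andbT.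
  by have := lM (- x); rewrite lN' normrN => ?; lra.
exists f => -[e c] /SA/lle /=.
by rewrite /pairing fl.
Qed.

(** Both the bound and the conclusion are positively homogeneous, so they pass
    to the cone generated by a convex set. *)
Theorem hahn_banach_convex (S : set (E * R^o)) M : 0 <= M ->
  (forall p q t, 0 < t < 1 -> S p -> S q -> S (t *: p + (1 - t) *: q)) ->
  above_norm M S -> exists l : dual_space E, forall p, S p -> ⟨p.1, l⟩ <= p.2.
Proof.
move=> M0 cS nS.
pose K := [set q | q = 0 \/ exists t p, [/\ 0 < t, S p & q = t *: p]].
have [||l lK] := @hahn_banach_cone K M M0.
- split; first by left.
  + move=> _ _ [->|[t [p [t0 Sp ->]]]] [->|[s [q [s0 Sq ->]]]].
    * by left; rewrite addr0.
    * by right; exists s, q; rewrite add0r.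
    * by right; exists t, p; rewrite addr0.
    * have ts0 : 0 < t + s by rewrite addr_gt0.
      have tsn : t + s != 0 by rewrite gt_eqF.
      right; exists (t + s), ((t / (t + s)) *: p + (1 - t / (t + s)) *: q).
      split => //.
        apply: cS => //; rewrite divr_gt0//= ltr_pdivrMr// mul1r ltrDl//.
      rewrite scalerDr !scalerA; congr (_ *: _ + _ *: _); first by field.
      by field.
  + move=> t _ t0 [->|[s [p [s0 Sp ->]]]]; first by left; rewrite scaler0.
    move: t0; rewrite le_eqVlt => /predU1P[<-|t0].
      by left; rewrite scale0r.
    by right; exists (t * s), p; rewrite scalerA mulr_gt0.
- move=> _ [->|[t [p [t0 Sp ->]]]] /=; first by rewrite normr0 mulr0 addr0.
  rewrite normrZ gtr0_norm// mulrCA -mulrDr mulr_ge0 ?(ltW t0)//.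
  exact: nS.
exists l => p Sp; apply: lK; right; exists 1, p.
by rewrite scale1r.
Qed.

End hahn_banach.

(** * Uniform boundedness principle *)

Section geometric.
Context {R : realType}.

(** The ratio is the one for which a tail of the series is at most half of the
    term before it. *)
Definition geometric_step (E : normedModType R) (c : R) (x : nat -> E) :=
  forall n, `|x n.+1 - x n| <= c * 3^-1 ^+ n.

Lemma geometric_step_dist (E : normedModType R) c (x : nat -> E) n m :
  0 <= c -> geometric_step c x -> (n <= m)%N ->
  `|x m - x n| <= c * (3 / 2) * 3^-1 ^+ n.
Proof.
move=> c0 cx /subnKC <-; move: (m - n)%N => {}m.
suff : `|x (n + m)%N - x n| <=
    c * (3 / 2) * 3^-1 ^+ n - c * (3 / 2) * 3^-1 ^+ (n + m).
  move/le_trans; apply; rewrite gerBl !mulr_ge0// exprn_ge0//.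
elim: m => [|m ih]; first by rewrite addn0 !subrr normr0.
rewrite addnS -(subrK (x (n + m)%N) (x (n + m).+1)) -addrA.
rewrite (le_trans (ler_normD _ _))//.
apply: (le_trans (lerD (cx (n + m)%N) ih)).
rewrite exprS; lra.
Qed.

Lemma geometric_step_cvg (E : completeNormedModType R) c (x : nat -> E) :
  0 <= c -> geometric_step c x ->
  exists2 l, x @ \oo --> l &
    forall n, `|l - x n| <= c * (3 / 2) * 3^-1 ^+ n.
Proof.
move=> c0 cx.
have cvx : cvg (x @ \oo).
  apply/cauchy_cvgP/cauchy_exP => e e0.
  have : (fun n => c * (3 / 2) * 3^-1 ^+ n : R) @ \oo --> (0 : R).
    rewrite -[X in _ --> X](mulr0 (c * (3 / 2))).
    apply: cvgMr; apply: cvg_expr; rewrite ger0_norm//.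
    by rewrite invf_lt1// ltr1n.
  move=> /cvgrPdist_lt/(_ e e0)[N _ /(_ N (leqnn N))]; rewrite sub0r normrN.
  move=> /ltr_normlW Ne; exists (x N).
  exists N => // m /= Nm; rewrite -ball_normE/= distrC.
  exact: le_lt_trans (geometric_step_dist c0 cx Nm) Ne.
exists (lim (x @ \oo)) => // n; apply/ler_addgt0Pr => e e0.
have /cvgrPdist_lt/(_ e e0)[N _ hN] := cvx.
have {hN} := hN (maxn N n) (leq_maxl N n).
move=> /ltW h; rewrite [leRHS]addrC.
rewrite -(subrK (x (maxn N n)) (lim _)) -addrA (le_trans (ler_normD _ _))//.
by rewrite lerD// geometric_step_dist// leq_maxr.
Qed.

(** Sequential completeness of a subset, tested on the sequences that the
    gliding hump argument produces. *)
Definition geometric_complete (E : normedModType R) (V : set E) :=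
  forall x : nat -> E, (forall n, V (x n)) -> geometric_step 1 x ->
  exists2 l, V l & forall n, `|l - x n| <= 3 / 2 * 3^-1 ^+ n.

Lemma closed_geometric_complete (E : completeNormedModType R) (V : set E) :
  closed V -> geometric_complete V.
Proof.
move=> cV x Vx gx; have [l xl lx] := geometric_step_cvg ler01 gx.
exists l; last by move=> n; rewrite -(mul1r (3 / 2)).
apply: (closed_cvg V cV _ _ xl).
by exists 0%N => // n _; exact: Vx.
Qed.

(** The limit is taken pointwise; the geometric error bounds are uniform on the
    unit ball, which makes the limit continuous and the convergence a
    convergence in norm. *)
Lemma dual_geometric_complete (E : normedModType R) :
  geometric_complete [set: dual_space E].
Proof.
move=> x _ gx.
have gxe e : geometric_step `|e| (fun n => x n e : R^o).
  move=> n; have := dual_norm_bound (x n.+1 - x n) e.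
  move=> /le_trans; apply.
  by rewrite mulrC ler_wpM2l// (le_trans (gx n))// mul1r.
have /choice[l lP] (e : E) : exists l : R^o, (fun n => x n e : R^o) @ \oo --> l /\
    forall n, `|l - x n e| <= `|e| * (3 / 2) * 3^-1 ^+ n.
  have [l xl lx] := geometric_step_cvg (normr_ge0 e) (gxe e).
  by exists l.
have llin a e e' : l (a *: e + e') = a * l e + l e'.
  have h1 : (fun n => x n (a *: e + e') : R^o) @ \oo --> (a * l e + l e' : R^o).
    have -> : (fun n => x n (a *: e + e') : R^o) =
        (fun n => a * x n e + x n e' : R^o).
      by apply/funext => n; rewrite linearP.
    apply: cvgD; last exact: (lP e').1.
    apply: cvgMr; exact: (lP e).1.
  exact: (cvg_unique _ (lP _).1 h1).
have lb n e : `|l e - x n e| <= 3 / 2 * 3^-1 ^+ n * `|e|.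
  by rewrite mulrC mulrA (lP e).2.
have [||f fl] := @bounded_linear_dual R E l (3 / 2 + `|x 0%N|) => //.
  move=> e; rewrite -(subrK (x 0%N e) (l e)) (le_trans (ler_normD _ _))//.
  rewrite mulrDl lerD ?dual_norm_bound//.
  by have := lb 0%N e; rewrite expr0 mulr1.
exists f => // n; apply: dual_bound_norm.
  by rewrite mulr_ge0// exprn_ge0.
move=> e; have -> : (f - x n) e = l e - x n e by rewrite -fl.
exact: lb.
Qed.

End geometric.

Section uniform_boundedness.
Context {R : realType} {E : normedModType R}.
Variables (V : set E).
Hypotheses (V0 : V 0) (Vlin : forall a x y, V x -> V y -> V (a *: x + y)).

(** [N] is the norm of [f] on [V]. Attaining two thirds of it is enough for the
    gliding hump, because the later terms of the series undo at most one half. *)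
Lemma near_norming_vector (f : dual_space E) (M : R) v : 0 <= M -> V v ->
  M * `|v| < `|f v| ->
  exists d N, [/\ V d, `|d| <= 1, M < N, 2 / 3 * N < `|f d| &
    forall w, V w -> `|f w| <= N * `|w|].
Proof.
move=> M0 Vv Mv.
have VZ a w : V w -> V (a *: w) by move=> Vw; rewrite -[_ *: _]addr0; exact: Vlin.
pose A := [set `|f w| | w in [set w | V w /\ `|w| <= 1]].
have sA : has_sup A.
  split; first by exists `|f 0|, 0 => //=; rewrite normr0.
  exists `|f| => _ [w /= [_ w1] <-]; exact: dual_norm_ge.
have vp : 0 < `|v|.
  rewrite normr_gt0; apply: contraTneq Mv => ->.
  by rewrite linear0 !normr0 mulr0 ltxx.
have fN w : V w -> `|f w| <= sup A * `|w|.
  move=> Vw; have [->|w0] := eqVneq w 0; first by rewrite linear0 !normr0 mulr0.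
  have wp : 0 < `|w| by rewrite normr_gt0.
  rewrite -ler_pdivrMr//; apply: sup_upper_bound => //.
  exists (`|w|^-1 *: w); first by split; [exact: VZ|rewrite normfZV].
  by rewrite linearZ/= normrM normfV normr_id mulrC.
have MN : M < sup A by rewrite -(ltr_pM2r vp) (lt_le_trans Mv)// fN.
have [|_ [d [Vd d1] <-] fd] := @sup_adherent _ A (sup A / 3) _ sA.
  by rewrite divr_gt0// (le_lt_trans M0 MN).
exists d, (sup A); split => //.
by apply: le_lt_trans fd; rewrite le_eqVlt; apply/orP; left; apply/eqP; lra.
Qed.

(** A gliding hump: were there no uniform bound, the sum of a geometric series of
    nearly norming vectors of functionals with quickly growing norms would be a
    point of [V] where the family is unbounded. The weight [rho] is that of
    bounds which grow with a parameter of the family. *)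
Theorem uniform_boundedness (I : Type) (S : set I) (g : I -> dual_space E)
    (rho : I -> R) : geometric_complete V ->
  (forall i, S i -> 0 < rho i) ->
  (forall v, V v -> exists K, forall i, S i -> ⟨v, g i⟩ <= K * rho i) ->
  exists2 M, 0 <= M &
    forall i v, S i -> V v -> `|⟨v, g i⟩| <= M * rho i * `|v|.
Proof.
move=> cV rho0 ptw; apply: contrapT => nM.
have VZ a w : V w -> V (a *: w) by move=> Vw; rewrite -[_ *: _]addr0; exact: Vlin.
have /choice[t tP] (n : nat) : exists t : I * E * R,
    [/\ (S t.1.1 /\ V t.1.2), `|t.1.2| <= 1,
      6 * n%:R * 3 ^+ n * rho t.1.1 < t.2,
      2 / 3 * t.2 < `|g t.1.1 t.1.2| &
      forall w, V w -> `|g t.1.1 w| <= t.2 * `|w|].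
  have c0 : 0 <= 6 * n%:R * 3 ^+ n :> R by rewrite !mulr_ge0// exprn_ge0.
  apply: contrapT => nt; apply: nM; exists (6 * n%:R * 3 ^+ n) => // i v Si Vv.
  rewrite leNgt; apply/negP => lt_gv; apply: nt.
  have r0 := ltW (rho0 _ Si).
  have [d [N [Vd d1 MN Nd Ng]]] :=
    near_norming_vector (mulr_ge0 c0 r0) Vv lt_gv.
  by exists (i, d, N).
(* The sign of the next term is chosen so that it adds up with the previous sum
   under the [n]-th functional. *)
pose h n (a b : E) : E :=
  if `|g (t n).1.1 b| <= `|g (t n).1.1 (a + b)| then a + b else a - b.
pose x := fix x n : E :=
  if n is m.+1 then h m (x m) (3^-1 ^+ m *: (t m).1.2) else 0.
have q0 n : 0 < 3^-1 ^+ n :> R by rewrite exprn_gt0// invr_gt0.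
have Vx n : V (x n).
  elim: n => //= n Vxn; rewrite /h.
  have [[_ Vd] _ _ _ _] := tP n.
  case: ifP => _; first by rewrite addrC; exact: Vlin.
  by rewrite -scaleNr addrC; exact: Vlin.
have gx : geometric_step 1 x.
  move=> n; rewrite mul1r/= /h; have [_ d1 _ _ _] := tP n.
  have qd : `|3^-1 ^+ n *: (t n).1.2| <= 3^-1 ^+ n.
    by rewrite normrZ gtr0_norm// ler_piMr// ltW.
  case: ifP => _; first by rewrite addrAC subrr add0r.
  by rewrite addrAC subrr add0r normrN.
have hump n : 3^-1 ^+ n * `|g (t n).1.1 (t n).1.2| <= `|g (t n).1.1 (x n.+1)|.
  rewrite -[X in X * _](gtr0_norm (q0 n)) -normrM.
  rewrite -[_ * _]/(_ *: (g (t n).1.1 (t n).1.2 : R^o)) -linearZ/= /h.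
  case: ifP => // /negbT; rewrite -ltNge.
  rewrite linearD linearB/=; move: (g _ _) (g _ _) => b a.
  rewrite ltr_norml => /andP[lb1 lb2].
  rewrite ler_norml; apply/andP; split.
    rewrite lerNl ler_normr; case: (ger0P b) lb1 lb2 => ? ? ?;
    apply/orP; [right|left]; lra.
  rewrite ler_normr; case: (ger0P b) lb1 lb2 => ? ? ?;
    apply/orP; [right|left]; lra.
have [l Vl xl] := cV x Vx gx.
have [K lK] := ptw l Vl.
have [K' lK'] := ptw (-1 *: l) (VZ _ _ Vl).
pose n := (Num.truncn (Num.max K K')).+1.
have nK : Num.max K K' < n%:R by apply: Num.Theory.truncnS_gt.
have [[Si Vd] _ nN Nd Ng] := tP n.
have ri := rho0 _ Si.
have gl : `|g (t n).1.1 l| <= n%:R * rho (t n).1.1.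
  have m : Num.max K K' * rho (t n).1.1 <= n%:R * rho (t n).1.1.
    by rewrite ler_wpM2r// ltW.
  rewrite ler_norml lerNl; apply/andP; split; apply: le_trans m.
    have := lK' _ Si; rewrite /pairing linearZ/= scaleN1r => /le_trans; apply.
    by rewrite ler_wpM2r ?(ltW ri)// le_max lexx orbT.
  have := lK _ Si => /le_trans; apply.
  by rewrite ler_wpM2r ?(ltW ri)// le_max lexx.
have Vlx : V (l - x n.+1).
  by rewrite addrC -scaleN1r; exact: Vlin.
have gap := le_trans (Ng _ Vlx) (ler_wpM2l _ (xl n.+1)).
have N0 : 0 < (t n).2.
  by apply: le_lt_trans nN; rewrite !mulr_ge0 ?exprn_ge0// ltW.
have {gap} gap := gap (ltW N0).
(* The hump is at least [2 / 3 * 3^-n * N] and the tail undoes at most half of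
   [3^-n * N]; the rest exceeds the pointwise bound. *)
have hn := hump n.
have tri : `|g (t n).1.1 (x n.+1)| <=
    `|g (t n).1.1 l| + `|g (t n).1.1 (l - x n.+1)|.
  by rewrite linearB/= -[X in `|X| <= _](subKr (g (t n).1.1 l)) ler_normB.
have small : n%:R * rho (t n).1.1 < 3^-1 ^+ n * (t n).2 / 6.
  rewrite ltr_pdivlMr// exprVn mulrC ltr_pdivlMl ?exprn_gt0//.
  by apply: le_lt_trans nN; rewrite le_eqVlt; apply/orP; left; apply/eqP; ring.
have := Nd; rewrite -(ltr_pM2l (q0 n)) => big.
move: gap; rewrite exprS => gap.
by lra.
Qed.

End uniform_boundedness.

(** * Brezis-Haraux theorem *)

(** The quadratic bound serves for [t <= 1] and the affine one for [1 <= t]. *)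
Lemma le_of_quadratic_affine (R : realType) (a b c t : R) : 0 <= a -> 0 <= b ->
  0 <= t -> - (a * (1 + t) * t) <= c -> - (b * (1 + t)) <= c ->
  0 <= c + (2 * a + 2 * b) * t.
Proof.
move=> a0 b0 t0 qa qb; have [t1|/ltW t1] := leP t 1.
  have : a * (1 + t) * t <= a * 2 * t.
    by rewrite ler_wpM2r// ler_wpM2l//; lra.
  have : 0 <= b * t by rewrite mulr_ge0.
  by lra.
have : b * (1 + t) <= b * (2 * t) by rewrite ler_wpM2l//; lra.
have : 0 <= a * t by rewrite mulr_ge0.
by lra.
Qed.

Section brezis_haraux.
Context {R : realType} {X : normedModType R}.
Variable T : X -> set (dual_space X).
Hypotheses (X_reflexive : reflexive_space X) (T_max : maximally_monotone T).

Let T_mono y v y' v' : T y v -> T y' v' -> 0 <= ⟨y - y', v - v'⟩.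
Proof. by move=> Tv Tv'; exact: ((T_max (y, v)).1 Tv (y', v') Tv'). Qed.

(** The value at [(x, t)] of the Fitzpatrick function of [T - u] is at most [K]. *)
Definition fitzpatrick_le (u : dual_space X) (x : X) (t : dual_space X) (K : R) :=
  forall y v, T y v -> ⟨x, v - u⟩ + ⟨y, t⟩ - ⟨y, v - u⟩ <= K.

(** The value at [(v, w)] of the conjugate of that function is at most [c]. *)
Definition fitzpatrick_conj_le (u : dual_space X) (w : X) (v : dual_space X) (c : R) :=
  forall x t K, fitzpatrick_le u x t K -> ⟨x, v⟩ + ⟨w, t⟩ - c <= K.

Lemma graph_fitzpatrick_le u y v : T y v ->
  fitzpatrick_le u y (v - u) ⟨y, v - u⟩.
Proof.
move=> Tv y' v' Tv'; have := T_mono Tv Tv'.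
by rewrite !(pairingBl, pairingBr); lra.
Qed.

(** If the inequality failed at [(w, v)], then [(w, v + u)] would be monotonically
    related to the graph of [T], hence would belong to it by maximality; but on
    the graph the Fitzpatrick function is the duality product. *)
Lemma fitzpatrick_conj_ge u w v c :
  fitzpatrick_conj_le u w v c -> ⟨w, v⟩ <= c.
Proof.
move=> wvc; rewrite leNgt; apply/negP => cwv.
have Tw : T w (v + u).
  apply: (T_max (w, v + u)).2 => -[y y'] /= Ty.
  have {}Ty : T y y' by [].
  have := wvc _ _ _ (graph_fitzpatrick_le u Ty).
  by move: cwv; rewrite !(pairingBl, pairingBr, pairingDr); lra.
have := wvc _ _ _ (graph_fitzpatrick_le u Tw).
by rewrite addrK; lra.
Qed.

(** Where [c <= 0], the points [w] are bounded by a multiple of [1 + |v|] at each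
    functional, thus in norm, so [c >= <w, v>] is at least a multiple of [- |v|]
    for small [v]; for large [v] the bound at the functional [0] gives the same.
    The linear minorant of [c] is
    a point [p] such that [<p, v - u> <= <y, v - u>] on the graph of [T], which
    maximality turns into [u] being a value of [T] at [p]. *)
Theorem surjective_of_bounded_above :
  (forall u, exists x K, forall y v, T y v -> ⟨x - y, v - u⟩ <= K) ->
  forall u, op_ran T u.
Proof.
move=> Tbd u.
have dF t : exists x K, fitzpatrick_le u x t K.
  have [x [K xK]] := Tbd (u + t); exists x, (K + ⟨x, t⟩) => y v Tv.
  by have := xK y v Tv; rewrite !(pairingBl, pairingBr, pairingDr); lra.
pose S (i : X * dual_space X * R) :=
  fitzpatrick_conj_le u i.1.1 i.1.2 i.2 /\ i.2 <= 0.
have /choice[ev evE] := @eval_dual R X.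
have bd t : exists2 K, 0 <= K & forall w v c, fitzpatrick_conj_le u w v c ->
    ⟨w, t⟩ - c <= K * (1 + `|v|).
  have [x [K xK]] := dF t; exists (`|K| + `|x|) => [|w v c /(_ _ _ _ xK)].
    exact: addr_ge0.
  have := pairing_le (- x) v; rewrite pairingNl normrN.
  have := ler_norm K.
  have : 0 <= `|K| * `|v| by exact: mulr_ge0.
  have := normr_ge0 x.
  by lra.
have [|||M M0 SM] := @uniform_boundedness R (dual_space X) setT I _ _ S
    (fun i => ev i.1.1) (fun i => 1 + `|i.1.2|) (@dual_geometric_complete R X).
- by [].
- by move=> i _; rewrite ltr_pwDl.
- move=> t _; have [K K0 tK] := bd t; exists K => -[[w v] c] [/= wvc c0].
  by rewrite evE; have := tK _ _ _ wvc; lra.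
have [K K0 Kc] := bd 0.
(* The epigraph of the partial infimum of the conjugate over [w]. *)
pose G := [set p : dual_space X * R^o | exists w, fitzpatrick_conj_le u w p.1 p.2].
have [|||l lG] := @hahn_banach_convex R (dual_space X) G (2 * M + 2 * K).
- by rewrite addr_ge0// mulr_ge0.
- move=> [v c] [v' c'] t /andP[t0 t1] [w /= wvc] [w' /= wvc'].
  exists (t *: w + (1 - t) *: w') => x s k xk /=.
  have := wvc _ _ _ xk; rewrite -subr_ge0 => /(mulr_ge0 (ltW t0)).
  have := wvc' _ _ _ xk; rewrite -subr_ge0 => /mulr_ge0 => /(_ (1 - t)).
  rewrite subr_ge0 => /(_ (ltW t1)).
  rewrite pairingDr !pairingZr pairingDl !pairingZl.
  rewrite -[t *: (c : R^o)]/(t * c) -[(1 - t) *: (c' : R^o)]/((1 - t) * c').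
  by lra.
- move=> [v c] [w /= wvc].
  have [c0|/ltW c0] := leP 0 c.
    by rewrite addr_ge0// mulr_ge0// addr_ge0// mulr_ge0.
  apply: le_of_quadratic_affine => //.
    have := SM (w, v, c) v (conj wvc c0) Logic.I; rewrite /= evE.
    rewrite ler_norml => /andP[+ _] => /le_trans; apply.
    exact: fitzpatrick_conj_ge wvc.
  have := Kc _ _ _ wvc; rewrite pairing0r; lra.
have [p pl] := X_reflexive l.
exists p => //; apply: (T_max (p, u)).2 => -[y v] /= Tv.
have : ⟨p, v - u⟩ <= ⟨y, v - u⟩.
  rewrite -pl; apply: (lG (v - u, ⟨y, v - u⟩)).
  by exists y => x t k /(_ _ _ Tv) /=; lra.
by rewrite !(pairingBl, pairingBr); lra.
Qed.

End brezis_haraux.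

(** * Fenchel-Moreau theorem *)

Section fenchel_moreau.
Context {R : realType} {X : normedModType R}.
Implicit Types f : X -> \bar R.

(** [f] is the supremum of its continuous affine minorants. *)
Definition affine_supported f := forall z (r : R), (r%:E < f z)%E ->
  exists l : dual_space X, forall x, ((r + ⟨x - z, l⟩)%:E <= f x)%E.

(** Convexity read on the epigraph: no product or sum of infinite values. *)
Definition epigraph_convex f := forall x y (r s t : R), 0 < t < 1 ->
  (f x <= r%:E)%E -> (f y <= s%:E)%E ->
  (f (t *: x + (1 - t) *: y)%R <= (t * r + (1 - t) * s)%:E)%E.

Lemma econvex_epigraph f : econvex f -> epigraph_convex f.
Proof.
move=> cf x y r s t t01 fx fy; apply: (le_trans (cf x y t t01)).
move: t01 => /andP[t0 t1]; rewrite [leRHS]EFinD !EFinM.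
by apply: leeD; apply: lee_wpmul2l => //; rewrite lee_fin ?subr_ge0 ltW.
Qed.

Lemma lower_semicontinuous_ball f z (r : R) : lower_semicontinuous f ->
  (r%:E < f z)%E ->
  exists2 d : R, 0 < d & forall x, `|x - z| < d -> (r%:E < f x)%E.
Proof.
move=> lf /lf[V /nbhs_ballP[d d0 dV] Vr]; exists d => // x xz.
by apply: Vr; apply: dV; rewrite -ball_normE/= distrC.
Qed.

(** Lower semicontinuity bounds [f] from below on a ball around a point of the
    domain, and convexity propagates the bound along rays. *)
Lemma Gamma0_norm_minorant f : Gamma0 f -> exists a b : R,
  0 <= b /\ forall x r, (f x <= r%:E)%E -> a - b * `|x| <= r.
Proof.
move=> [[fNy [x0 fx0]] lf cf].
have /fineK fx0E : f x0 \is a fin_num.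
  by rewrite fin_numE gt_eqF ?fNy//= lt_eqF.
set r0 := fine (f x0) in fx0E.
have [|d d0 fd] := @lower_semicontinuous_ball f x0 (r0 - 1) lf.
  by rewrite -fx0E lte_fin gtrBl.
(* Points at distance [e] lie inside the ball of radius [d]. *)
pose e := d / 2.
have e0 : 0 < e by rewrite divr_gt0.
suff fe x r : (f x <= r%:E)%E -> r0 - 1 - e^-1 * `|x - x0| <= r.
  exists (r0 - 1 - e^-1 * `|x0|), e^-1; split; first by rewrite invr_ge0 ltW.
  move=> x r /fe; apply: le_trans.
  have := ler_normB x x0; rewrite -(ler_pM2l (x := e^-1)) ?invr_gt0// mulrDr.
  lra.
move=> fx; have [xe|xe] := ltP `|x - x0| d.
  have : ((r0 - 1)%:E < r%:E)%E by exact: lt_le_trans (fd _ xe) fx.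
  rewrite lte_fin => /ltW; apply: le_trans.
  by rewrite gerBl mulr_ge0// invr_ge0 ltW.
have n0 : 0 < `|x - x0| by exact: lt_le_trans d0 xe.
pose t := e / `|x - x0|.
have t0 : 0 < t by rewrite divr_gt0.
have t1 : t < 1.
  by rewrite ltr_pdivrMr// mul1r (lt_le_trans _ xe)// ltr_pdivrMr// ltr_pMr// ltr1n.
have fr0 : (f x0 <= r0%:E)%E by rewrite fx0E.
have := econvex_epigraph cf _ fx fr0 => /(_ t); rewrite t0 t1 => /(_ isT).
have x'x0 : t *: x + (1 - t) *: x0 - x0 = t *: (x - x0).
  by rewrite scalerBl scale1r scalerBr addrA addrAC addrK.
have /fd /lt_le_trans h : `|t *: x + (1 - t) *: x0 - x0| < d.
  rewrite x'x0 normrZ gtr0_norm// divfK ?gt_eqF//.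
  by rewrite ltr_pdivrMr// ltr_pMr// ltr1n.
move=> /h; rewrite lte_fin => {}h.
have : t * (r0 - e^-1 * `|x - x0|) <= t * r.
  rewrite mulrBr mulrA (_ : t * e^-1 * _ = 1); last first.
    by rewrite /t; field; rewrite !gt_eqF.
  lra.
rewrite ler_pM2l//; apply: le_trans; lra.
Qed.

(** The distance from [(z, r)], strictly below the graph, to the epigraph is
    controlled linearly: near [z] by lower semicontinuity, far away by a
    minorant that is affine in the norm. *)
Theorem Gamma0_affine_supported f : Gamma0 f -> affine_supported f.
Proof.
move=> Gf; have [[fNy _] lf cf] := Gf.
have [a [b [b0 fab]]] := Gamma0_norm_minorant Gf.
move=> z r rfz.
have [d d0 fd] := lower_semicontinuous_ball lf rfz.
(* The gap at [z] between [r] and the minorant; the slope [k / d] fills it outside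
   the ball of radius [d]. *)
pose k := Num.max 0 (r - a + b * `|z|).
have k0 : 0 <= k by rewrite le_max lexx.
pose G := [set p : X * R^o | exists x s,
  [/\ (f x <= s%:E)%E, p.1 = x - z & p.2 = s - r]].
have [|||l lG] := @hahn_banach_convex R X G (b + k / d).
- by rewrite addr_ge0// divr_ge0// ltW.
- move=> [_ _] [_ _] t t01 [x [s /= [fx -> ->]]] [y [s' /= [fy -> ->]]].
  exists (t *: x + (1 - t) *: y), (t * s + (1 - t) * s'); split => /=.
  + exact: (econvex_epigraph cf).
  + rewrite !scalerBr addrACA -opprD; congr (_ - _).
    by rewrite -scalerDl addrCA subrr addr0 scale1r.
  + rewrite -[t *: (_ : R^o)]/(t * (s - r)).
    by rewrite -[(1 - t) *: (_ : R^o)]/((1 - t) * (s' - r)); ring.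
- move=> [_ _] [x [s /= [fx -> ->]]].
  have [xz|xz] := ltP `|x - z| d.
    have /ltW : (r%:E < s%:E)%E by exact: lt_le_trans (fd _ xz) fx.
    rewrite lee_fin -subr_ge0 => rs.
    by rewrite addr_ge0// mulr_ge0// addr_ge0// divr_ge0// ltW.
  have := fab _ _ fx.
  have : k <= k / d * `|x - z|.
    by rewrite mulrAC ler_pdivlMr// ler_wpM2l.
  have : r - a + b * `|z| <= k by rewrite le_max lexx orbT.
  have := ler_normD (x - z) z; rewrite subrK => /(ler_wpM2l b0).
  lra.
exists l => x.
case fx : (f x) => [s| |]; last by have := fNy x; rewrite fx.
- rewrite lee_fin addrC -lerBrDr.
  by apply: (lG (x - z, s - r)); exists x, s; rewrite fx.
- by rewrite leey.
Qed.

End fenchel_moreau.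

(** * Sum of two subdifferentials *)

Section subdifferential_sum.
Context {R : realType} {X : completeNormedModType R}.
Implicit Types f h : X -> \bar R.

(** The value at [v] of the conjugate of [f] is at most [s], tested on the
    epigraph of [f] so that only real numbers occur. *)
Definition conj_le f (v : dual_space X) (s : R) :=
  forall a r, (f a <= r%:E)%E -> ⟨a, v⟩ - r <= s.

Lemma fdom_le f x : fdom f x -> exists r : R, (f x <= r%:E)%E.
Proof.
rewrite /fdom/=; case: (f x) => [r _| |_]; last by exists 0; rewrite leNye.
- by exists r.
- by rewrite ltxx.
Qed.

Lemma le_fdom f x (r : R) : (f x <= r%:E)%E -> fdom f x.
Proof. by move=> fx; exact: le_lt_trans fx (ltry _). Qed.

Variables (f h : X -> \bar R) (u : dual_space X).
Hypotheses (cf : epigraph_convex f) (ch : epigraph_convex h).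
Hypothesis fh_dom :
  closed_subspace (cone_gen (mdiff (fdom f) (fdom h))).
Hypothesis fh_conj : forall t : dual_space X, exists a b r s,
  [/\ t = a + b, conj_le f a r & conj_le h b s].

(** The sum of the primal and dual objectives for minimizing [f + h - u], the
    dual variable [v] being a slope of [f]. The perturbations [w] and [s] shift
    the arguments of [f] and of the conjugate of [h]; the objective at
    [w = 0], [s = 0] is nonnegative and vanishes exactly at solutions. *)
Definition primal_dual z v w s (c : R) := exists r1 r2 r3 r4 : R,
  [/\ (f (z + w)%R <= r1%:E)%E, (h z <= r2%:E)%E, conj_le f v r3,
      conj_le h (u + s - v) r4 & c = r1 + r2 + r3 + r4 - ⟨z, u⟩].

(** Fenchel-Young for [f] at [(z + w, v)] and for [h] at [(z, u + s - v)]. *)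
Lemma primal_dual_ge z v w s c : primal_dual z v w s c ->
  ⟨w, v⟩ + ⟨z, s⟩ <= c.
Proof.
move=> [r1 [r2 [r3 [r4 [f1 h2 /(_ _ _ f1) + /(_ _ _ h2) + ->]]]]].
by rewrite !(pairingDl, pairingBr, pairingDr); lra.
Qed.

Lemma primal_dual_convex z v w s c z' v' w' s' c' t : 0 < t < 1 ->
  primal_dual z v w s c -> primal_dual z' v' w' s' c' ->
  primal_dual (t *: z + (1 - t) *: z') (t *: v + (1 - t) *: v')
    (t *: w + (1 - t) *: w') (t *: s + (1 - t) *: s') (t * c + (1 - t) * c').
Proof.
move=> t01 [r1 [r2 [r3 [r4 [f1 h2 v3 v4 ->]]]]].
move=> [q1 [q2 [q3 [q4 [f1' h2' v3' v4' ->]]]]].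
exists (t * r1 + (1 - t) * q1), (t * r2 + (1 - t) * q2).
exists (t * r3 + (1 - t) * q3), (t * r4 + (1 - t) * q4).
have /andP[t0 t1] := t01; have {}t1 : 0 <= 1 - t by lra.
have conjc (g : X -> \bar R) b b' k k' : conj_le g b k -> conj_le g b' k' ->
    conj_le g (t *: b + (1 - t) *: b') (t * k + (1 - t) * k').
  move=> bk bk' a r ga; rewrite pairingDr !pairingZr.
  have := ler_wpM2l (ltW t0) (bk _ _ ga); have := ler_wpM2l t1 (bk' _ _ ga).
  by lra.
split.
- have -> : t *: z + (1 - t) *: z' + (t *: w + (1 - t) *: w') =
      t *: (z + w) + (1 - t) *: (z' + w') by rewrite !scalerDr addrACA.
  exact: cf.
- exact: ch.
- exact: conjc.
- have -> : u + (t *: s + (1 - t) *: s') - (t *: v + (1 - t) *: v') =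
      t *: (u + s - v) + (1 - t) *: (u + s' - v').
    have {1}-> : u = t *: u + (1 - t) *: u.
      by rewrite -scalerDl addrC subrK scale1r.
    by rewrite !scalerBr !scalerDr opprD (addrACA (t *: u)) [LHS]addrACA.
  exact: conjc.
- by rewrite pairingDl !pairingZl; ring.
Qed.

Let V := cone_gen (mdiff (fdom f) (fdom h)).

Let Vsub : V 0 /\ forall a x y, V x -> V y -> V (a *: x + y).
Proof.
have [_ [V0 Vl]] := fh_dom; split; first exact: set_mem V0.
by move=> a x y Vx Vy; apply: set_mem; apply: Vl; exact: mem_set.
Qed.

Lemma domain_meet : exists y, fdom f y /\ fdom h y.
Proof.
have [[t /= t0 [_ [c fc [d hd <-]] tcd0]] _] := Vsub.
have /eqP := tcd0; rewrite scaler_eq0 gt_eqF//= subr_eq0 => /eqP cd.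
by exists c; rewrite {2}cd.
Qed.

(** The decomposition [t = a + b] bounds [<z, t>] by the primal half of the
    objective: Fenchel-Young for [f] at [(z + w, a)] and for [h] at [(z, b)]. *)
Lemma primal_part_ge t : exists2 k, 0 <= k & forall z w r1 r2,
  (f (z + w)%R <= r1%:E)%E -> (h z <= r2%:E)%E ->
  ⟨z, t⟩ <= r1 + r2 + k * (1 + `|w|).
Proof.
have [a [b [r [s [-> ar bs]]]]] := fh_conj t.
exists (`|r| + `|s| + `|a|); first by rewrite !addr_ge0.
move=> z w r1 r2 /ar fzw /bs hz; move: fzw hz.
have := pairing_le (- w) a; rewrite pairingNl normrN.
have := ler_norm r; have := ler_norm s.
have : 0 <= (`|r| + `|s|) * `|w| by rewrite mulr_ge0// addr_ge0.
have := normr_ge0 a.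
by rewrite pairingDl pairingDr; lra.
Qed.

(** The mirror image of [primal_part_ge]: Fenchel-Young for [f] at [(c, v)] and for
    [h] at [(d, u + s - v)], where [y = c - d]. *)
Lemma dual_part_ge y : mdiff (fdom f) (fdom h) y ->
  exists2 k, 0 <= k & forall v s r3 r4,
  conj_le f v r3 -> conj_le h (u + s - v) r4 ->
  ⟨y, v⟩ <= r3 + r4 + k * (1 + `|s|).
Proof.
move=> [c /fdom_le[r fc] [d /fdom_le[q hd] <-]].
exists (`|r| + `|q| + `|⟨d, u⟩| + `|d|); first by rewrite !addr_ge0.
move=> v s r3 r4 /(_ _ _ fc) v3 /(_ _ _ hd); move: v3.
have := pairing_le (- d) s; rewrite pairingNl normrN.
have := ler_norm r; have := ler_norm q; have := ler_norm (- ⟨d, u⟩).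
rewrite normrN.
have : 0 <= (`|r| + `|q| + `|⟨d, u⟩|) * `|s| by rewrite mulr_ge0// !addr_ge0.
have := normr_ge0 d.
by rewrite pairingBl pairingBr pairingDr; lra.
Qed.

Lemma dual_part_lower : exists2 k, 0 <= k & forall v s r3 r4,
  conj_le f v r3 -> conj_le h (u + s - v) r4 -> - (k * (1 + `|s|)) <= r3 + r4.
Proof.
have [y [fy hy]] := domain_meet.
have [|k k0 kP] := @dual_part_ge 0; first by exists y => //; exists y; rewrite ?subrr.
exists k => // v s r3 r4 v3 v4; have := kP _ _ _ _ v3 v4.
by rewrite pairing0l; lra.
Qed.

Let weight (i : X * dual_space X * X * dual_space X * R) : R :=
  1 + (`|i.1.1.2| + `|i.1.2|).

Let nonpositive : set (X * dual_space X * X * dual_space X * R) :=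
  [set i | primal_dual i.1.1.1.1 i.1.1.1.2 i.1.1.2 i.1.2 i.2 /\ i.2 <= 0].

Lemma weight_gt0 i : 0 < weight i.
Proof. by rewrite ltr_pwDl// addr_ge0. Qed.

(** [primal_part_ge] bounds [z] at every point of the dual space, the primal half
    being bounded above as the objective is nonpositive and its dual half is
    bounded below. *)
Lemma primal_variable_bound : exists2 M, 0 <= M &
  forall z v w s c, primal_dual z v w s c -> c <= 0 ->
  `|⟨z, s⟩| <= M * (1 + (`|w| + `|s|)) * `|s|.
Proof.
have /choice[ev evE] := @eval_dual R X.
have [k2 k20 k2P] := dual_part_lower.
have [||||M M0 MP] := @uniform_boundedness R (dual_space X) setT _ _ _
    nonpositive (fun i => ev i.1.1.1.1) weight (@dual_geometric_complete R X).
- by [].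
- by [].
- by move=> i _; exact: weight_gt0.
- move=> t _; have [k k0 kP] := primal_part_ge (t + u).
  exists (k + k2) => -[[[[z v] w] s] c].
  move=> [/= [r1 [r2 [r3 [r4 [f1 h2 v3 v4 ->]]]]] c0].
  have := kP _ _ _ _ f1 h2; have := k2P _ _ _ _ v3 v4.
  have : 0 <= k * `|s| by rewrite mulr_ge0.
  have : 0 <= k2 * `|w| by rewrite mulr_ge0.
  by rewrite evE pairingDr /weight/=; lra.
exists M => // z v w s c zc c0.
by have := MP (z, v, w, s, c) s (conj zc c0) I; rewrite /= evE.
Qed.

(** [dual_part_ge] bounds [v] at every point of the closed subspace generated by
    the difference of the domains only, but this is where [w] lives. Being closed
    makes that subspace complete. *)
Lemma dual_variable_bound : exists2 M, 0 <= M &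
  forall z v w s c, primal_dual z v w s c -> c <= 0 ->
  `|⟨w, v⟩| <= M * (1 + (`|w| + `|s|)) * `|w|.
Proof.
have [k1 k10 k1P] := primal_part_ge u.
have [V0 Vlin] := Vsub.
have [||M M0 MP] := @uniform_boundedness R X V V0 Vlin _ nonpositive
    (fun i => i.1.1.1.2) weight (closed_geometric_complete fh_dom.1).
- by move=> i _; exact: weight_gt0.
- move=> _ [t /= t0 [y Dy <-]]; have [k k0 kP] := dual_part_ge Dy.
  exists (t * (k + k1)) => -[[[[z v] w] s] c].
  move=> [/= [r1 [r2 [r3 [r4 [f1 h2 v3 v4 ->]]]]] c0].
  rewrite pairingZl -mulrA ler_pM2l//.
  have := k1P _ _ _ _ f1 h2; have := kP _ _ _ _ v3 v4.
  have : 0 <= k * `|w| by rewrite mulr_ge0.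
  have : 0 <= k1 * `|s| by rewrite mulr_ge0.
  by rewrite /weight/=; lra.
exists M => // z v w s c zc c0.
apply: (MP (z, v, w, s, c) w (conj zc c0)) => /=.
have [r1 [r2 [r3 [r4 [f1 h2 _ _ _]]]]] := zc.
exists 1 => //=; exists w; last by rewrite scale1r.
exists (z + w); first exact: le_fdom f1.
by exists z; [exact: le_fdom h2|rewrite addrC addKr].
Qed.

Lemma primal_dual_calm : exists2 M, 0 <= M &
  forall z v w s c, primal_dual z v w s c -> 0 <= c + M * (`|w| + `|s|).
Proof.
have [k1 k10 k1P] := primal_part_ge u.
have [k2 k20 k2P] := dual_part_lower.
have [M1 M10 M1P] := primal_variable_bound.
have [M2 M20 M2P] := dual_variable_bound.
exists (2 * (M1 + M2) + 2 * (k1 + k2)).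
  by rewrite addr_ge0// mulr_ge0// addr_ge0.
move=> z v w s c zc; have [c0|/ltW c0] := leP 0 c.
  by rewrite addr_ge0// mulr_ge0 ?addr_ge0// mulr_ge0// addr_ge0.
have w0 := normr_ge0 w; have s0 := normr_ge0 s.
apply: le_of_quadratic_affine; rewrite ?addr_ge0//.
  apply: le_trans (primal_dual_ge zc).
  have := M1P _ _ _ _ _ zc c0; rewrite ler_norml => /andP[+ _].
  have := M2P _ _ _ _ _ zc c0; rewrite ler_norml => /andP[+ _].
  have : 0 <= M1 * (1 + (`|w| + `|s|)) * `|w| by rewrite !mulr_ge0// !addr_ge0.
  have : 0 <= M2 * (1 + (`|w| + `|s|)) * `|s| by rewrite !mulr_ge0// !addr_ge0.
  lra.
have [r1 [r2 [r3 [r4 [f1 h2 v3 v4 ->]]]]] := zc.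
have := k1P _ _ _ _ f1 h2; have := k2P _ _ _ _ v3 v4.
have : 0 <= k1 * `|s| by rewrite mulr_ge0.
have : 0 <= k2 * `|w| by rewrite mulr_ge0.
lra.
Qed.

(** The minorant of the perturbed objective given by the Hahn-Banach theorem is
    a pair made of a primal and a dual solution. *)
Lemma primal_dual_minorant : reflexive_space X -> exists z0 v0,
  forall z v w s c, primal_dual z v w s c -> ⟨w, v0⟩ + ⟨z0, s⟩ <= c.
Proof.
move=> rX; have [M M0 MP] := primal_dual_calm.
pose G := [set p : (X * dual_space X) * R^o |
  exists z v, primal_dual z v p.1.1 p.1.2 p.2].
have [|||l lG] := @hahn_banach_convex R (X * dual_space X)%type G (M * 2).
- by rewrite mulr_ge0.
- move=> [[w s] c] [[w' s'] c'] t t01 [z [v /= zc]] [z' [v' /= zc']].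
  exists (t *: z + (1 - t) *: z'), (t *: v + (1 - t) *: v').
  exact: primal_dual_convex.
- move=> [[w s] c] [z [v /= /MP]] /le_trans; apply.
  rewrite lerD2l -mulrA ler_wpM2l// mulr_natl mulr2n prod_normE/=.
  by rewrite lerD// le_max lexx ?orbT.
have lB p : `|⟨p, l⟩| <= `|l| * `|p| by exact: dual_norm_bound.
have [|w|v0 v0E] := @bounded_linear_dual R X (fun w => ⟨(w, 0), l⟩) `|l|.
- move=> a x y; rewrite -pairingZl -pairingDl; congr (⟨_, l⟩).
  by rewrite /GRing.scale/= /GRing.add/= /scale_pair/add_pair/= scaler0 addr0.
- apply: (le_trans (lB _)); rewrite ler_wpM2l// prod_normE/= normr0.
  by rewrite ge_max lexx/=.
have [|s|F FE] := @bounded_linear_dual R (dual_space X) (fun s => ⟨(0, s), l⟩) `|l|.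
- move=> a x y; rewrite -pairingZl -pairingDl; congr (⟨_, l⟩).
  by rewrite /GRing.scale/= /GRing.add/= /scale_pair/add_pair/= scaler0 addr0.
- apply: (le_trans (lB _)); rewrite ler_wpM2l// prod_normE/= normr0.
  by rewrite ge_max lexx/= normr_ge0.
have [z0 z0E] := rX F.
exists z0, v0 => z v w s c zc.
have -> : ⟨w, v0⟩ + ⟨z0, s⟩ = ⟨(w, s), l⟩.
  rewrite -z0E [X in X + _]v0E [X in _ + X]FE -pairingDl.
  by rewrite /GRing.add/= /add_pair/= addr0 add0r.
by apply: (lG ((w, s), c)); exists z, v.
Qed.

(** The minorant says that the conjugates of [f] and [h] at [v] and [u - v] and
    their biconjugates at [z] add up to at most [<z, u>]. As [f] and [h] equal
    their biconjugates, equality holds in both Fenchel-Young inequalities. *)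
Theorem subdiff_sum_surjective : reflexive_space X ->
  (forall y, -oo < f y)%E -> (forall y, -oo < h y)%E ->
  affine_supported f -> affine_supported h ->
  exists z v, subdiff f z v /\ subdiff h z (u - v).
Proof.
move=> rX fNy hNy fl hl.
have [z [v zvP]] := primal_dual_minorant rX.
have sum_le a b r1 r2 p q : (f a <= r1%:E)%E -> (h b <= r2%:E)%E ->
    (p%:E < f z)%E -> (q%:E < h z)%E ->
    ⟨a, v⟩ - r1 + (⟨b, u - v⟩ - r2) + p + q <= ⟨z, u⟩.
  move=> fa hb /fl[l lP] /hl[m mP].
  have cl : conj_le f l (⟨z, l⟩ - p).
    move=> x s /(le_trans (lP x)); rewrite lee_fin pairingBl; lra.
  have cm : conj_le h m (⟨z, m⟩ - q).
    move=> x s /(le_trans (mP x)); rewrite lee_fin pairingBl; lra.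
  have := zvP b l (a - b) (m + l - u)
    (r1 + r2 + (⟨z, l⟩ - p) + (⟨z, m⟩ - q) - ⟨b, u⟩).
  rewrite !(pairingBl, pairingBr, pairingDr) => H.
  suff /H : primal_dual b l (a - b) (m + l - u)
    (r1 + r2 + (⟨z, l⟩ - p) + (⟨z, m⟩ - q) - ⟨b, u⟩) by lra.
  exists r1, r2, (⟨z, l⟩ - p), (⟨z, m⟩ - q); split => //.
    by rewrite addrC subrK.
  by rewrite [u + _]addrC subrK addrK.
(* Both values at [z] are finite: at an infinite one, [p] or [q] could grow without
   bound in [sum_le]. *)
have below (y : \bar R) : (-oo < y)%E -> exists q : R, (q%:E < y)%E.
  case: y => [r _| _|//]; last by exists 0; rewrite ltry.
  by exists (r - 1); rewrite lte_fin gtrBl.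
have [p0 p0f] := below _ (fNy z).
have [q0 q0h] := below _ (hNy z).
have [a [/fdom_le[ra fa] /fdom_le[rb hb]]] := domain_meet.
have [F Fz] : exists F : R, f z = F%:E.
  case fz : (f z) => [r| |]; [by exists r| |by have := fNy z; rewrite fz].
  have := sum_le a a ra rb (⟨z, u⟩ + 1 - (⟨a, v⟩ - ra + (⟨a, u - v⟩ - rb) + q0))
    q0 fa hb.
  by rewrite fz ltry => /(_ isT q0h); lra.
have [H Hz] : exists H : R, h z = H%:E.
  case hz : (h z) => [r| |]; [by exists r| |by have := hNy z; rewrite hz].
  have := sum_le a a ra rb p0
    (⟨z, u⟩ + 1 - (⟨a, v⟩ - ra + (⟨a, u - v⟩ - rb) + p0)) fa hb p0f.
  by rewrite hz ltry => /(_ isT); lra.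
have {}sum_le b c r1 r2 : (f b <= r1%:E)%E -> (h c <= r2%:E)%E ->
    ⟨b, v⟩ - r1 + (⟨c, u - v⟩ - r2) + F + H <= ⟨z, u⟩.
  move=> fb hc; apply/ler_addgt0Pr => e e0.
  have := sum_le b c r1 r2 (F - e / 2) (H - e / 2) fb hc.
  rewrite Fz Hz !lte_fin !gtrBl divr_gt0// => /(_ isT isT); lra.
exists z, v; split => y.
- rewrite Fz; case fy : (f y) => [r| |]; last by have := fNy y; rewrite fy.
    have := sum_le y z r H; rewrite fy Hz !lexx => /(_ isT isT).
    by rewrite -EFinD lee_fin !(pairingBl, pairingBr); lra.
  by rewrite leey.
- rewrite Hz; case hy : (h y) => [r| |]; last by have := hNy y; rewrite hy.
    have := sum_le z y F r; rewrite hy Fz !lexx => /(_ isT isT).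
    by rewrite -EFinD lee_fin !(pairingBl, pairingBr); lra.
  by rewrite leey.
Qed.

End subdifferential_sum.

(** * Operations on subdifferentials and conjugates *)

Section subdifferential.
Context {R : realType} {X : normedModType R}.
Implicit Types f phi : X -> \bar R.

Lemma subdiff_fin phi y b : proper_fun phi -> subdiff phi y b ->
  exists r : R, phi y = r%:E.
Proof.
move=> [phiNy [x phix]] /(_ x); move: phix; rewrite /fdom/=.
case py : (phi y) => [r| |]; [by exists r| |by have := phiNy y; rewrite py].
by rewrite addey// => /lt_le_trans H /H; rewrite ltxx.
Qed.

(** Add the subgradient inequalities from [y] to [x] and from a point of
    [subdiff phi] with slope [u] to [y]: the values at [y] cancel. *)
Lemma subdiff_bounded_above phi x u : proper_fun phi ->
  op_dom (subdiff phi) x -> op_ran (subdiff phi) u ->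
  exists K, forall y v, subdiff phi y v -> ⟨x - y, v - u⟩ <= K.
Proof.
move=> pp [b xb] [a _ au].
have [rx px] := subdiff_fin pp xb; have [ra pa] := subdiff_fin pp au.
exists (rx - ra + ⟨a - x, u⟩) => y v yv; have [ry py] := subdiff_fin pp yv.
have := yv x; have := au y; rewrite px pa py -!EFinD !lee_fin.
by rewrite !(pairingBl, pairingBr); lra.
Qed.

Lemma subdiff_monotone phi : proper_fun phi -> monotone (subdiff phi).
Proof.
move=> pp [x u] [y v] /= xu yv; have {}xu : subdiff phi x u by [].
have {}yv : subdiff phi y v by [].
have [rx px] := subdiff_fin pp xu; have [ry py] := subdiff_fin pp yv.
have := xu y; have := yv x; rewrite px py -!EFinD !lee_fin.
by rewrite !(pairingBl, pairingBr); lra.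
Qed.

Lemma subdiff_tilt phi u z q : subdiff (tilt phi u) z q <-> subdiff phi z (q + u).
Proof.
split=> zq y; have := zq y; rewrite /tilt.
- case: (phi z) (phi y) => [r| |] [s| |]//=; rewrite ?leey ?leNye//.
  by rewrite -?EFinN -!EFinD !lee_fin !(pairingBl, pairingDr); lra.
- case: (phi z) (phi y) => [r| |] [s| |]//=; rewrite ?leey ?leNye//.
  by rewrite -?EFinN -!EFinD !lee_fin !(pairingBl, pairingDr); lra.
Qed.

Lemma subdiff_scale gamma phi z q : 0 < gamma ->
  subdiff (fun y => gamma%:E * phi y)%E z q <->
  mscale gamma (subdiff phi z) q.
Proof.
move=> g0.
have gy : (gamma%:E * +oo = +oo)%E by rewrite gt0_muley ?lte_fin.
have gNy : (gamma%:E * -oo = -oo)%E by rewrite gt0_muleNy ?lte_fin.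
have iff_le p y : ((⟨y - z, p⟩)%:E + phi z <= phi y)%E <->
    ((⟨y - z, gamma *: p⟩)%:E + gamma%:E * phi z <= gamma%:E * phi y)%E.
  rewrite pairingZr; case: (phi z) (phi y) => [r| |] [s| |];
    rewrite ?gy ?gNy ?addey ?addeNy ?leey ?leNye//.
  by rewrite -!EFinM -!EFinD !lee_fin -mulrDr ler_pM2l.
split=> [zq|[p zp <-] y]; last exact/iff_le.
exists (gamma^-1 *: q); last by rewrite scalerA mulfV ?gt_eqF// scale1r.
move=> y; apply/iff_le; rewrite scalerA mulfV ?gt_eqF// scale1r; exact: zq.
Qed.

End subdifferential.

Section conjugate.
Context {R : realType} {X : completeNormedModType R}.
Implicit Types f : X -> \bar R.

Lemma fconjugate_leP f v s : (forall y, -oo < f y)%E ->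
  (fconjugate f v <= s%:E)%E <-> conj_le f v s.
Proof.
move=> fNy; split=> [fvs a r far|fvs].
  rewrite -lee_fin; apply: le_trans fvs.
  apply: (@le_trans _ _ ((⟨a, v⟩)%:E - f a)%E); last first.
    by apply: ereal_sup_ubound; exists a.
  by rewrite EFinB leeB.
apply: ge_ereal_sup => _ [a _ <-].
case fa : (f a) => [r| |]; last by have := fNy a; rewrite fa.
  by rewrite -EFinB lee_fin; apply: fvs; rewrite fa.
by rewrite addeNy leNye.
Qed.

(** The conjugate is finite at the slope of an affine minorant of [f], and the
    subgradient inequality at [a] tested there bounds the conjugate at [a]. *)
Lemma dom_subdiff_fconjugate f a : (forall y, -oo < f y)%E ->
  affine_supported f -> op_dom (subdiff (fconjugate f)) a ->
  exists s, conj_le f a s.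
Proof.
move=> fNy fl [F aF].
have [r r0] : exists r : R, (r%:E < f 0%R)%E.
  case: (f 0%R) (fNy 0%R) => [r _| _|//]; last by exists 0; rewrite ltry.
  by exists (r - 1); rewrite lte_fin gtrBl.
have [l lP] := fl _ _ r0.
have /(fconjugate_leP _ _ fNy) lr : conj_le f l (- r).
  move=> b s /(le_trans (lP b)); rewrite lee_fin subr0; lra.
exists (- r - ⟨l - a, F⟩); apply/fconjugate_leP => //.
have := le_trans (aF l) lr.
case: (fconjugate f a) => [s| |]; rewrite ?leNye//.
by rewrite -EFinD !lee_fin; lra.
Qed.

End conjugate.

Section scaling.
Context {R : realType} {X : completeNormedModType R}.
Variables (phi : X -> \bar R) (gamma : R).
Hypothesis gamma_gt0 : 0 < gamma.
Let h := fun y => (gamma%:E * phi y)%E.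

Lemma scale_le y r : ((h y <= r%:E) = (phi y <= (gamma^-1 * r)%:E))%E.
Proof. by rewrite EFinM lee_pdivlMl. Qed.

Lemma scale_gtNy : (forall y, -oo < phi y)%E -> forall y, (-oo < h y)%E.
Proof.
move=> phiNy y; rewrite /h; case: (phi y) (phiNy y) => [r _| _|//].
  by rewrite -EFinM ltNyr.
by rewrite gt0_muley ?lte_fin// ltNyy.
Qed.

Lemma scale_fdom : fdom h = fdom phi.
Proof.
apply/seteqP; split=> y /fdom_le[r]; rewrite ?scale_le.
  exact: le_fdom.
by move=> pr; apply: (@le_fdom _ _ _ _ (gamma * r)); rewrite scale_le mulKf ?gt_eqF.
Qed.

Lemma scale_epigraph_convex : epigraph_convex phi -> epigraph_convex h.
Proof.
move=> cp x y r s t t01; rewrite !scale_le => xr ys.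
by rewrite mulrDr !(mulrCA gamma^-1); exact: cp.
Qed.

Lemma scale_affine_supported : affine_supported phi -> affine_supported h.
Proof.
move=> lp z r; rewrite /h -lte_pdivrMl// -EFinM => /lp[l lP].
exists (gamma *: l) => x; rewrite -lee_pdivrMl// -EFinM.
by rewrite mulrDr pairingZr mulKf ?gt_eqF.
Qed.

Lemma scale_conj_le v s : conj_le phi v s -> conj_le h (gamma *: v) (gamma * s).
Proof.
move=> vs a r; rewrite scale_le => /vs; rewrite pairingZr.
by rewrite -(ler_pM2l gamma_gt0) mulrBr mulVKf ?gt_eqF.
Qed.

End scaling.

(** * The sum of [W] and a multiple of a subdifferential *)

Section ranges.
Context {R : realType} {X : completeNormedModType R}.
Variables (phi : X -> \bar R) (D : set X) (W : D -> dual_space X) (gamma : R).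
Hypotheses (X_reflexive : reflexive_space X) (phi_proper : proper_fun phi).
Hypothesis gamma_gt0 : 0 < gamma.
Let A := op_add (op_of W) (op_scale gamma (subdiff phi)).

Lemma sum_graph (d : D) q : subdiff phi (val d) q -> A (val d) (W d + gamma *: q).
Proof. by move=> dq; exists (W d); [exists d|exists (gamma *: q) => //; exists q]. Qed.

Lemma sum_graphP y p : A y p -> exists (d : D) q,
  [/\ y = val d, p = W d + gamma *: q & subdiff phi (val d) q].
Proof. by move=> [_ [d /= <- <-] [_ [q yq <-] <-]]; exists d, q. Qed.

Lemma op_of_mem (d : D) : op_of W (val d) (W d).
Proof. by exists d. Qed.

Lemma warped_prox_tiltP u (x : D) z :
  warped_prox (op_of W) (fun y => gamma%:E * tilt phi u y)%E (val x) z <->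
  A z (W x + gamma *: u).
Proof.
split.
- move=> [_ [d /= /val_inj -> <-] [_ [e /= <- <-] [q]]].
  move=> /(subdiff_scale _ _ _ gamma_gt0)[p /subdiff_tilt ep <-] <-.
  by rewrite -addrA -scalerDr; exact: sum_graph.
- move=> /sum_graphP[d [q [-> eq_Wq dq]]]; exists (W x); first exact: op_of_mem.
  exists (W d); first exact: op_of_mem.
  exists (gamma *: (q - u)).
    apply/(subdiff_scale _ _ _ gamma_gt0); exists (q - u) => //.
    by apply/subdiff_tilt; rewrite subrK.
  by rewrite scalerBr addrA -eq_Wq addrK.
Qed.

(** When [W] is uniformly monotone, the graph points of the sum over a common
    value satisfy [<y - y', W y - W y'> <= 0] by monotonicity of [subdiff phi],
    so the modulus vanishes at [|y - y'|]. *)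
Lemma sum_injective :
  op_injective A \/ strictly_monotone A \/ uniformly_monotone (op_of W) ->
  op_injective A.
Proof.
move=> [//|[[_ sA]|[m [m0 _ mE0 mW]]]] y y' [p [Ayp Ay'p]].
  apply/eqP; apply: contrapT => /negP yy'.
  by have := sA (y, p) (y', p) Ayp Ay'p yy'; rewrite subrr pairing0r ltxx.
have [d [q [yd pq dq]]] := sum_graphP Ayp.
have [d' [q' [y'd pq' d'q]]] := sum_graphP Ay'p.
have := mW (val d, W d) (val d', W d') (op_of_mem d) (op_of_mem d').
have := subdiff_monotone phi_proper (p := (val d, q)) (q := (val d', q')) dq d'q.
rewrite /= => mq mw.
have : (m `|val d - val d'|%R <= 0)%E.
  apply: (le_trans mw); rewrite lee_fin.
  have -> : W d - W d' = gamma *: (q' - q).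
    apply/eqP; rewrite scalerBr subr_eq addrAC -subr_eq opprK.
    by rewrite -pq addrC -pq'.
  rewrite pairingZr -(opprB q q') pairingNr mulrN oppr_le0 mulr_ge0 ?(ltW gamma_gt0)//.
move=> le0; have /eqP : m `|val d - val d'|%R = 0%E.
  by apply/eqP; rewrite eq_le le0 m0.
move=> /eqP/(mE0 _ (normr_ge0 _))/eqP; rewrite normr_eq0 subr_eq0 => /eqP.
by rewrite yd y'd.
Qed.

Lemma star_monotone_le x u : star_monotone (op_of W) -> op_dom (op_of W) x ->
  op_ran (op_of W) u ->
  exists K : R, forall d : D, ⟨x - val d, W d - u⟩ <= K.
Proof.
move=> [_ sW] Wx Wu; have := sW x u Wx Wu; set S := ereal_sup _ => Soo.
have SP (d : D) : ((⟨x - val d, W d - u⟩)%:E <= S)%E.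
  by apply: ereal_sup_ubound; exists (val d, W d) => //; exact: op_of_mem.
case: S Soo SP => [K _ KP| //|_ NP]; first by exists K => d; rewrite -lee_fin.
by exists 0 => d; have := NP d.
Qed.

(** The sum inherits from its two terms an upper bound for [<x - y, v - p>] at a
    common point [x]. For [W] it comes from the [3*] property at any point of
    the domain, or from monotonicity when [x] is a point where [W] takes the
    value [u]. *)
Lemma sum_surjective : D `&` op_dom (subdiff phi) !=set0 ->
  monotone (op_of W) -> maximally_monotone A ->
  (forall p, exists u (d : D) (q : dual_space X),
    [/\ p = u + gamma *: q, op_ran (op_of W) u, op_ran (subdiff phi) q &
        star_monotone (op_of W) \/ u = W d /\ op_dom (subdiff phi) (val d)]) ->
  forall p, op_ran A p.
Proof.
move=> [x [Dx px]] mW mA dec; apply: surjective_of_bounded_above => // p.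
have [u [d [q [-> Wu rq sd]]]] := dec p.
have [y [K [py yK]]] : exists y K, op_dom (subdiff phi) y /\
    forall e : D, ⟨y - val e, W e - u⟩ <= K.
  case: sd => [sW|[-> pd]].
    have Wx : op_dom (op_of W) x.
      by exists (W (exist _ x (mem_set Dx))); exists (exist _ x (mem_set Dx)).
    by have [K KP] := star_monotone_le sW Wx Wu; exists x, K.
  exists (val d), 0; split=> // e.
  have := mW (val d, W d) (val e, W e) (op_of_mem d) (op_of_mem e).
  by rewrite /= -(opprB (W e)) pairingNr oppr_ge0.
have [L yL] := subdiff_bounded_above phi_proper py rq.
exists y, (K + gamma * L) => _ _ /sum_graphP[e [q' [-> -> eq']]].
have := yK e; have := ler_wpM2l (ltW gamma_gt0) (yL _ _ eq').
by rewrite !(pairingBl, pairingBr, pairingDr, pairingZr); lra.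
Qed.

(** At a point of the domain of its subdifferential the conjugate is finite, so
    each functional splits into two at which the conjugates of [f] and of
    [gamma * phi] are finite. *)
Lemma sum_surjective_of_conjugates (f : X -> \bar R) : Gamma0 f ->
  op_of W = subdiff f -> Gamma0 phi ->
  closed_subspace (cone_gen (mdiff (fdom f) (fdom phi))) ->
  msum (op_dom (subdiff (fconjugate f)))
    (mscale gamma (op_dom (subdiff (fconjugate phi)))) = setT ->
  forall p, op_ran A p.
Proof.
move=> Gf WE Gp cV dT p.
have [[fNy _] _ cf] := Gf; have [[pNy _] _ cp] := Gp.
have fl := Gamma0_affine_supported Gf; have pl := Gamma0_affine_supported Gp.
pose h := fun y => (gamma%:E * phi y)%E.
have [|||||||||z [v [fv hv]]] := @subdiff_sum_surjective R X f h p.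
- exact: econvex_epigraph.
- by apply: scale_epigraph_convex => //; exact: econvex_epigraph.
- by rewrite scale_fdom.
- move=> t; have : [set: dual_space X] t by [].
  rewrite -dT => -[a fa [_ [b pb <-] <-]].
  have [r ar] := dom_subdiff_fconjugate fNy fl fa.
  have [s bs] := dom_subdiff_fconjugate pNy pl pb.
  by exists a, (gamma *: b), r, (gamma * s); split => //; exact: scale_conj_le.
- exact: X_reflexive.
- exact: fNy.
- exact: scale_gtNy.
- exact: fl.
- exact: scale_affine_supported.
exists z => //; exists v; first by rewrite WE.
by exists (p - v); [exact/subdiff_scale|rewrite addrC subrK].
Qed.

End ranges.

Unset Implicit Arguments.

Theorem theorem6p5 (R : realType) (X : completeNormedModType R)
  (X_neq0 : exists v : X, v != 0) (X_reflexive : reflexive_space X)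
  (phi : X -> \bar R) (phi_proper : proper_fun phi)
  (D : set X) (D_neq0 : D !=set0) (W : D -> dual_space X)
  (x : D) (u : dual_space X) (gamma : R) (gamma_gt0 : 0 < gamma)
  (A := op_add (op_of W) (op_scale gamma (subdiff phi))) :
  D `&` op_dom (subdiff phi) !=set0 ->
  op_injective A \/
  strictly_monotone A \/
  uniformly_monotone (op_of W) ->
  op_ran A (W x + gamma *: u) \/
  [/\ monotone (op_of W), maximally_monotone A,
      msum (op_ran (op_of W)) (mscale gamma (op_ran (subdiff phi))) = setT &
      star_monotone (op_of W) \/ op_dom (op_of W) `<=` op_dom (subdiff phi)] \/
  (exists f : X -> \bar R,
    [/\ Gamma0 f, op_of W = subdiff f, Gamma0 phi,
        closed_subspace (cone_gen (mdiff (fdom f) (fdom phi))) &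
        msum (op_dom (subdiff (fconjugate f)))
             (mscale gamma (op_dom (subdiff (fconjugate phi)))) = setT]) \/
  [/\ monotone (op_of W), maximally_monotone A &
      (star_monotone (op_of W) /\ op_surjective (op_of W)) \/
      op_surjective (subdiff phi)] ->
  exists z : D,
    warped_prox (op_of W) (fun y => gamma%:E * tilt phi u y)%E (val x)
      = [set val z] /\
    (((⟨val x - val z, W x - W z⟩) / gamma)%:E <= fenchel_young phi (val x) u)%E.
Proof.
move=> Dphi inj_cond ran_cond.
have injA := sum_injective phi_proper gamma_gt0 inj_cond.
have /= xran : op_ran A (W x + gamma *: u).
  case: ran_cond => [//|[[mW mA sumT st]|[[f [Gf WE Gp cV dT]]|[mW mA st]]]].
  - apply: sum_surjective => // p.
    have : [set: dual_space X] p by [].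
    rewrite -sumT => -[_ [y _ [d dy <-]] [_ [q rq <-] <-]].
    exists (W d), d, q; split => //; first by exists (val d) => //; exact: op_of_mem.
    case: st => [|dd]; [by left|right; split => //].
    by apply: dd; exists (W d); exact: op_of_mem.
  - exact: sum_surjective_of_conjugates Gf WE Gp cV dT _.
  - apply: sum_surjective => // p.
    have [y [Dy [b yb]]] := Dphi; pose d : D := exist _ y (mem_set Dy).
    have rW e : op_ran (op_of W) (W e) by exists (val e) => //; exact: op_of_mem.
    case: st => [[sW surW]|surphi].
      exists (p - gamma *: b), d, b; split.
      + by rewrite subrK.
      + by rewrite surW.
      + by exists y.
      + by left.
    exists (W d), d, (gamma^-1 *: (p - W d)); split => //.
    + by rewrite scalerA mulfV ?gt_eqF// scale1r addrC subrK.
    + by rewrite surphi.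
    + by right; split => //; exists b.
have [z _ Az] := xran.
have [d [q [zd eq_dq dq]]] := sum_graphP Az.
exists d; split.
  apply/seteqP; split=> [z'|_ ->].
    move=> /(warped_prox_tiltP _ _ gamma_gt0) Az'; rewrite /= -zd; apply: injA.
    by exists (W x + gamma *: u).
  by apply/warped_prox_tiltP => //; rewrite -zd.
have [r pr] := subdiff_fin phi_proper dq.
have -> : (⟨val x - val d, W x - W d⟩) / gamma =
    ⟨val x - val d, q⟩ - ⟨val x - val d, u⟩.
  rewrite -pairingBr -[W x](addrK (gamma *: u)) eq_dq.
  rewrite addrAC (addrC (W d)) addrK -scalerBr pairingZr mulrAC divff ?mul1r//.
  by rewrite gt_eqF.
have conj_ge : ((⟨val d, u⟩ - r)%:E <= fconjugate phi u)%E.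
  by apply: ereal_sup_ubound; exists (val d) => //; rewrite pr.
have := dq (val x); rewrite pr -EFinD => phi_ge.
rewrite /fenchel_young EFinB.
apply: (@le_trans _ _ ((⟨val x - val d, q⟩ + r)%:E + (⟨val d, u⟩ - r)%:E -
    (⟨val x, u⟩)%:E)%E); last by rewrite leeB// leeD.
by rewrite -!EFinD lee_fin !pairingBl; lra.
Qed.
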